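(* Let $n\ge 2$, let $G$ be any finite group, let $W_n=G\wr S_n$, and let $\Gamma=([n],c)$ be a weighted hypergraph with non-negative weights. If $\Gamma$ has no almost-isolated vertex, then for every $\rho\in\operatorname{Irr}(W_n)\setminus\operatorname{Irr}_0(W_n)$, $$\lambda_{\min}(\Gamma,\rho)>\lambda_{\min}^*\left(\Gamma,\mathrm{Reg}_{W_n}\right).$$
   Context: Notation: $[n]=\{1,\dots,n\}$; $e$ is the unit of a group. A weighted hypergraph $\Gamma=([n],c)$ is an assignment of a weight $c_B\in\mathbb{R}_{\ge 0}$ to every subset $B\subseteq[n]$. A vertex $i\in[n]$ is almost-isolated if $c_B=0$ for every $B$ with $i\in B\subsetneq[n]$ ($c_{[n]}$ may be positive). $W_n=G\wr S_n=G^n\rtimes S_n$ has elements $(\mathbf g;\sigma)$ with $\mathbf g=(g_1,\dots,g_n)\in G^n$, $\sigma\in S_n$, and multiplication $(g_1,\dots,g_n;\sigma)(h_1,\dots,h_n;\tau)=(g_1h_{\sigma^{-1}(1)},\dots,g_nh_{\sigma^{-1}(n)};\sigma\tau)$. For $B\subseteq[n]$: $S_B=\{\sigma\in S_n:\sigma(i)=i\ \forall i\notin B\}$, $W_B=\{(\mathbf g;\sigma)\in W_n:\sigma\in S_B,\ g_i=e_G\ \forall i\notin B\}$, $J_B^{(G)}=\frac1{|W_B|}\sum_{w\in W_B}w\in\mathbb{C}[W_n]$, and $\mathcal L_\Gamma^{(G)}=\sum_{B\subseteq[n]}c_B(e-J_B^{(G)})\in\mathbb{C}[W_n]$. For a finite-dimensional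 complex representation $\rho$ of $W_n$, the eigenvalues of $\rho(\mathcal L_\Gamma^{(G)})$ are real and non-negative; $\lambda_{\min}(\Gamma,\rho)$ is the smallest one. Writing $\rho\cong\rho'\oplus k\cdot\mathrm{triv}$ with $\rho'$ having no trivial component, $\lambda_{\min}^*(\Gamma,\rho)$ is the smallest eigenvalue of $\rho'(\mathcal L_\Gamma^{(G)})$ ($\infty$ if $\rho'=0$). $\mathrm{Reg}_{W_n}$ is the left-regular representation on $\mathbb{C}[W_n]$. $\operatorname{Irr}(H)$ is the set of isomorphism classes of irreducible complex representations of a finite group $H$. The irreducible representations of $W_n$ are indexed by multi-partitions $\vec\mu$: functions from $\operatorname{Irr}(G)$ to the set of all integer partitions with $\sum_{\theta}|\vec\mu(\theta)|=n$; $\operatorname{supp}(\vec\mu)=\{\theta:\vec\mu(\theta)\ne\emptyset\}$. The representation $\rho_{\vec\mu}$ is constructed as follows. Let $\operatorname{supp}(\vec\mu)=\{\theta_1,\dots,\theta_k\}$, $m_i=|\vec\mu(\theta_i)|$, $\vec m=(m_1,\dots,m_k)$, let $S_{\vec m}\cong S_{m_1}\times\cdots\times S_{m_k}\le S_n$ be the Young subgroup permuting separately the consecutive blocks of sizes $m_1,\dots,m_k$ of $[n]$, and $W_{\vec m}=G^n\rtimes S_{\vec m}$. Let $\vartheta=\theta_1^{\boxtimes m_1}\boxtimes\cdots\boxtimes\theta_k^{\boxtimes m_k}\in\operatorname{Irr}(G^n)$, and let $\varrho$ be the representation of $W_{\vec m}$ on the space of $\vartheta$ where $G^n$ acts by $\vartheta$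 and $S_{\vec m}$ acts by permuting tensor coordinates. Let $\tau_{\vec\mu}=\boxtimes_i\tau_{\vec\mu(\theta_i)}\in\operatorname{Irr}(S_{\vec m})$, where $\tau_\mu$ is the irreducible representation of $S_m$ indexed by $\mu\vdash m$, and $\tilde\tau_{\vec\mu}$ its pullback along $W_{\vec m}\to S_{\vec m}$. Then $\rho_{\vec\mu}=\operatorname{Ind}_{W_{\vec m}}^{W_n}(\varrho\otimes\tilde\tau_{\vec\mu})$. Finally $\operatorname{Irr}_0(W_n)=\{\rho_{\vec\mu}:\operatorname{supp}(\vec\mu)=\{\mathrm{triv}_G\}\}$. *)

(* Defs.v *)
From HB Require Import structures.
From mathcomp Require Import all_classical all_reals ereal.
From mathcomp Require Import all_boot all_order all_algebra.
From mathcomp Require Import all_fingroup all_solvable all_field all_character.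
From mathcomp Require Import complex.

Set Implicit Arguments.
Unset Strict Implicit.
Unset Printing Implicit Defensive.

Import Order.TTheory GRing.Theory Num.Theory.

Local Open Scope ring_scope.
Local Open Scope complex_scope.

Section WreathProduct.

Variables (G : finGroupType) (n : nat).

Record wreath := Wreath { wbase : {ffun 'I_n -> G}; wperm : 'S_n }.

Definition wreath_pair (w : wreath) := (wbase w, wperm w).
Definition pair_wreath p := Wreath p.1 p.2.

Lemma wreath_pairK : cancel wreath_pair pair_wreath.
Proof. by case. Qed.

HB.instance Definition _ := Finite.copy wreath (can_type wreath_pairK).

Implicit Types u v w : wreath.

(* For permutations, (s * t)%g is "s first, then t"; the product of S_n used
   here is composition of functions, so the factors are swapped. *)
Definition wreath_mul u v :=
  Wreath [ffun i => wbase u i * wbase v ((wperm u)^-1 i)]%g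
         (wperm v * wperm u)%g.
Definition wreath_one := Wreath [ffun => 1%g] 1%g.
Definition wreath_inv u :=
  Wreath [ffun i => (wbase u (wperm u i))^-1]%g (wperm u)^-1%g.

Lemma wreath_mulA : associative wreath_mul.
Proof.
move=> u v w; congr Wreath; last by rewrite /= mulgA.
by apply/ffunP=> i; rewrite !ffunE /= invMg permM mulgA.
Qed.

Lemma wreath_mul1 : left_id wreath_one wreath_mul.
Proof.
case=> g s; congr Wreath; last by rewrite /= mulg1.
by apply/ffunP=> i; rewrite !ffunE /= invg1 perm1 mul1g.
Qed.

Lemma wreath_mulV : left_inverse wreath_one wreath_inv wreath_mul.
Proof.
move=> u; congr Wreath; last by rewrite /= mulgV.
by apply/ffunP=> i; rewrite !ffunE /= invgK mulVg.
Qed.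

HB.instance Definition _ := Finite_isGroup.Build wreath
  wreath_mulA wreath_mul1 wreath_mulV.

Lemma wperm1 : wperm 1%g = 1%g. Proof. by []. Qed.

Lemma wpermM u v : wperm (u * v)%g = (wperm v * wperm u)%g. Proof. by []. Qed.

Lemma wbase1 i : wbase 1%g i = 1%g. Proof. by rewrite ffunE. Qed.

Lemma wbaseM u v i :
  wbase (u * v)%g i = (wbase u i * wbase v ((wperm u)^-1 i))%g.
Proof. by rewrite ffunE. Qed.

Definition wreath_sub (B : {set 'I_n}) : {set wreath} :=
  [set w | [forall (i | i \notin B), (wperm w i == i) && (wbase w i == 1%g)]].

End WreathProduct.

Section Laplacian.

Variables (R : realType) (G : finGroupType) (n : nat).

Record whypergraph := WHypergraph {
  weight :> {set 'I_n} -> R;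
  weight_ge0 : forall B, 0 <= weight B }.

Definition almost_isolated (Gamma : whypergraph) (i : 'I_n) :=
  forall B : {set 'I_n}, i \in B -> B \proper [set: 'I_n] -> Gamma B = 0.

Local Notation W := (wreath G n).

(* The group algebra is encoded as the span of the matrices of regular_repr.
   These act on row vectors by right translation; as a homomorphism to
   matrices, regular_repr is isomorphic, by inversion in W, to the left-regular
   representation. *)
Definition Javg (B : {set 'I_n}) : 'M[R[i]]_#|[set: W]%G| :=
  #|wreath_sub G B|%:R^-1 *: gset_mx R[i] [set: W]%G (wreath_sub G B).

Definition laplacian (Gamma : whypergraph) : 'M[R[i]]_#|[set: W]%G| :=
  \sum_(B : {set 'I_n}) (Gamma B)%:C *: (1%:M - Javg B).

End Laplacian.

Section Representations.

Variables (F : fieldType) (gT : finGroupType).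
Implicit Type H : {group gT}.

Lemma triv_mx_repr H : mx_repr H (fun _ : gT => 1%:M : 'M[F]_1).
Proof. by split=> // x y _ _; rewrite mulmx1. Qed.

Definition triv_grepr H : representation F H :=
  Representation (MxRepresentation (triv_mx_repr H)).

Definition prod_grepr H (r1 r2 : representation F H) : representation F H :=
  Representation (prod_repr r1 r2).

Definition constituent H d1 (tau : mx_representation F H d1)
    d2 (rho : mx_representation F H d2) :=
  exists (U : 'M[F]_d2) (modU : mxmodule rho U), mx_rsim tau (submod_repr modU).

(* The matrix representation on a space with a basis indexed by X, with
   entries K g x y. *)
Section Kernel.

Variables (T : finType) (X : {set T}) (K : gT -> T -> T -> F).

Definition kernel_mx g : 'M[F]_#|X| :=
  \matrix_(a, b) K g (enum_val a) (enum_val b).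

Lemma kernel_mx_repr H :
    {in X &, forall x y, K 1%g x y = (x == y)%:R} ->
    {in H &, forall g h, {in X &, forall x z,
      K (g * h)%g x z = \sum_(y in X) K g x y * K h y z}} ->
  mx_repr H kernel_mx.
Proof.
move=> K1 KM; split=> [|g h Hg Hh]; apply/matrixP=> a b; rewrite !mxE.
  by rewrite K1 ?enum_valP // (inj_eq enum_val_inj).
rewrite KM ?enum_valP // big_enum_val.
by apply: eq_bigr => c _; rewrite !mxE.
Qed.

End Kernel.

(* The row index (A, i) stands for the i-th basis vector in the copy of the
   module attached to the right coset A of H. *)
Section Induced.

Variables (L H : {group gT}) (d : nat) (rho : mx_representation F H d).

Definition ind_basis := setX (rcosets H L) [set: 'I_d].

Definition ind_kernel g (x y : {set gT} * 'I_d) : F :=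
  let z := (repr x.1 * g * (repr y.1)^-1)%g in
  if z \in H then rho z x.2 y.2 else 0.

Hypothesis sHL : H \subset L.

Lemma repr_rcosets A : A \in rcosets H L -> repr A \in L /\ A = (H :* repr A)%g.
Proof.
case/rcosetsP=> x Lx ->; split; last by rewrite rcoset_repr.
have /rcosetP[h Hh ->] := mem_repr_rcoset H x.
by rewrite groupM // (subsetP sHL).
Qed.

Lemma ind_mx_repr : mx_repr L (kernel_mx ind_basis ind_kernel).
Proof.
apply: kernel_mx_repr => [[A i] [B j] | g h Lg Lh [A i] [B j]].
  rewrite !inE /= !andbT => /repr_rcosets[LA defA] /repr_rcosets[LB defB].
  rewrite /ind_kernel /= mulg1 -mem_rcoset xpair_eqE.
  have ->: (repr A \in H :* repr B)%g = (A == B).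
    apply/idP/eqP=> [/rcoset_eqP eqAB | ->]; first by rewrite defA eqAB -defB.
    by rewrite -defB defB; exact: mem_repr_rcoset.
  by case: eqP => [->|]; rewrite //= mulgV repr_mx1 mxE.
rewrite !inE /= !andbT => Lix Ljx.
have [LA defA] := repr_rcosets Lix; have [LB defB] := repr_rcosets Ljx.
pose C0 := (H :* (repr A * g))%g.
have LC0 : C0 \in rcosets H L by apply/rcosetsP; exists (repr A * g)%g; rewrite ?groupM.
have [LC defC] := repr_rcosets LC0.
have HC C : C \in rcosets H L ->
    (repr A * g * (repr C)^-1 \in H)%g = (C == C0).
  move=> /repr_rcosets[_ defC']; rewrite -mem_rcoset -defC'.
  apply/idP/eqP=> [|->]; last exact: rcoset_refl.
  by rewrite {1}defC' => /rcoset_eqP; rewrite -defC'.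
rewrite (eq_bigl (fun x : {set gT} * 'I_d => (x.1 \in rcosets H L) && true)); last first.
  by move=> [C k]; rewrite !inE.
rewrite -(pair_big_dep (fun C => C \in rcosets H L) (fun _ _ => true)
  (fun C k => ind_kernel g (A, i) (C, k) * ind_kernel h (C, k) (B, j))) /=.
rewrite (bigD1 C0) //= [X in _ + X]big1 ?addr0 => [|C /andP[LCC neC]]; last first.
  by apply: big1 => k _; rewrite /ind_kernel /= HC // (negPf neC) mul0r.
have Hz : (repr A * g * (repr C0)^-1 \in H)%g by rewrite HC.
rewrite /ind_kernel /= Hz.
have -> : (repr A * (g * h) * (repr B)^-1 =
  (repr A * g * (repr C0)^-1) * (repr C0 * h * (repr B)^-1))%g.
  by rewrite !mulgA mulgKV.
rewrite groupMl //; case: ifP => Hz'; last by rewrite big1 // => k _; rewrite mulr0.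
by rewrite repr_mxM // mxE.
Qed.

Definition ind_repr := MxRepresentation ind_mx_repr.

End Induced.

End Representations.

Section Spectrum.

Variables (R : realType) (gT : finGroupType) (H : {group gT}).
Local Notation C := R[i].

(* gring_op rho a is rho(a); the infimum is a minimum, as the sets of
   eigenvalues are finite, and it is +oo on the empty set. *)
Definition lambda_min (a : 'M[C]_#|H|) d (rho : mx_representation C H d) :=
  ereal_inf [set (x%:E)%E | x in
    [set x : R | eigenvalue (gring_op rho a) x%:C]]%classic.

Definition lambda_min_star (a : 'M[C]_#|H|) d
    (rho : mx_representation C H d) :=
  ereal_inf [set (x%:E)%E | x in
    [set x : R | exists (rho' : representation C H) (k : nat),
      [/\ mx_rsim rho (dadd_grepr rho' (muln_grepr (triv_grepr C H) k)),
          ~ constituent (triv_grepr C H) rho'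
        & eigenvalue (gring_op rho' a) x%:C]]]%classic.

End Spectrum.

(* 'I_n cut into consecutive blocks of sizes p 0, p 1, .. *)
Section YoungSubgroup.

Variables (k : nat) (p : 'I_k -> nat) (n : nat) (e : (\sum_i p i)%N = n).

Definition block_sig (j : 'I_n) : {i & 'I_(p i)} :=
  tagnat.sig (cast_ord (esym e) j).
Definition block_rank (u : {i & 'I_(p i)}) : 'I_n :=
  cast_ord e (tagnat.rank u).
Definition block (j : 'I_n) : 'I_k := tag (block_sig j).

Lemma block_rankK : cancel block_rank block_sig.
Proof. by move=> u; rewrite /block_sig /block_rank cast_ordK tagnat.rankK. Qed.

Lemma block_sigK : cancel block_sig block_rank.
Proof. by move=> j; rewrite /block_sig /block_rank tagnat.sigK cast_ordKV. Qed.

Definition young_set : {set 'S_n} :=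
  [set s : 'S_n | [forall j, block (s j) == block j]].

Lemma youngP (s : 'S_n) : reflect (forall j, block (s j) = block j) (s \in young_set).
Proof. by rewrite inE; apply: 'forall_eqP. Qed.

Lemma young_group_set : group_set young_set.
Proof.
apply/group_setP; split=> [|s t /youngP Ys /youngP Yt].
  by apply/youngP=> j; rewrite perm1.
by apply/youngP=> j; rewrite permM Yt Ys.
Qed.
Canonical young := Group young_group_set.

Local Notation bpoint a := (Tagged (fun i => 'I_(p i)) a).

(* The permutation induced on the i-th block. *)
Definition block_perm (i : 'I_k) (s : 'S_n) : 'S_(p i) :=
  let f (a : 'I_(p i)) : 'I_(p i) :=
    tagged_as (bpoint a) (block_sig (s (block_rank (bpoint a)))) in
  insubd (1%g : 'S_(p i)) (finfun f).

Lemma bpoint_inj i : injective (fun a : 'I_(p i) => bpoint a).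
Proof. by move=> b c /eqP; rewrite eq_Tagged => /eqP. Qed.

Lemma block_permE i s (a : 'I_(p i)) : s \in young ->
  bpoint (block_perm i s a) = block_sig (s (block_rank (bpoint a))).
Proof.
move=> Ys; pose f (b : 'I_(p i)) : 'I_(p i) :=
  tagged_as (bpoint b) (block_sig (s (block_rank (bpoint b)))).
have Tf b : bpoint (f b) = block_sig (s (block_rank (bpoint b))).
  rewrite /f; have := youngP _ Ys (block_rank (bpoint b)).
  rewrite /block block_rankK; case: (block_sig _) => i' c /= di'.
  by case: _ / (esym di') in c *; rewrite tagged_asE.
have injf : injective f.
  move=> b c /(congr1 (fun x => bpoint x)); rewrite !Tf.
  by move/(can_inj block_sigK)/perm_inj/(can_inj block_rankK)/bpoint_inj.
rewrite -Tf; congr (bpoint _).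
have -> : block_perm i s = perm injf.
  by apply: val_inj; rewrite val_insubd perm_proof //= [in RHS]unlock.
by rewrite permE.
Qed.

Lemma block_perm1 i : block_perm i 1%g = 1%g.
Proof.
apply/permP=> a; apply: bpoint_inj.
by rewrite block_permE ?group1 // !perm1 block_rankK.
Qed.

Lemma block_permM i : {in young &, {morph block_perm i : s t / (s * t)%g}}.
Proof.
move=> s t Ys Yt; apply/permP=> a; apply: bpoint_inj.
by rewrite permM !block_permE ?groupM // permM block_sigK.
Qed.

End YoungSubgroup.

Section SymmetricGroup.

Variable F : fieldType.

Definition is_partition (mu : seq nat) := sorted geq mu && (0%N \notin mu).

Lemma sum_nth_sumn (mu : seq nat) m : sumn mu = m ->
  (\sum_(r < size mu) nth 0%N mu r)%N = m.
Proof. by move <-; rewrite sumnE (big_nth 0%N) big_mkord. Qed.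

(* M^mu, the representation of S_m induced from the trivial representation of
   the Young subgroup of type mu. *)
Definition young_perm_repr m (mu : seq nat) (e : sumn mu = m) :=
  ind_repr (triv_grepr F (young (sum_nth_sumn e))) (subsetT _).

Definition dominates (la mu : seq nat) :=
  forall k, (sumn (take k mu) <= sumn (take k la))%N.

(* The irreducible representation indexed by mu: in characteristic 0, by
   Young's rule, the Specht module S^mu is, up to isomorphism, the only
   irreducible constituent of M^mu which is not a constituent of M^la for any
   partition la strictly dominating mu. *)
Definition is_specht m (mu : seq nat) (e : sumn mu = m)
    d (tau : mx_representation F [set: 'S_m]%G d) :=
  [/\ mx_irreducible tau,
      constituent tau (young_perm_repr e)
    & forall (la : seq nat) (e' : sumn la = m),
        is_partition la -> dominates la mu -> la <> mu ->
        ~ constituent tau (young_perm_repr e')].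

End SymmetricGroup.

Section IrreducibleWreath.

Variables (C : decFieldType) (G : finGroupType) (n : nat).

(* Every irreducible representation of G is isomorphic to irr_repr theta for
   exactly one theta : Irr_index when the characteristic is 0. *)
Definition Irr_index : irrType C [set: G]%G :=
  DecSocleType (regular_repr C [set: G]%G).

Local Notation IrrG := (socle_sort Irr_index).

Definition is_multipartition (mu : IrrG -> seq nat) :=
  (forall theta, is_partition (mu theta)) /\
  (\sum_theta sumn (mu theta))%N = n.

Definition msupp (mu : IrrG -> seq nat) : {set IrrG} :=
  [set theta | mu theta != [::]].

Section RhoMu.

Variable mu : IrrG -> seq nat.
Hypothesis mu_n : is_multipartition mu.

Local Notation k := #|msupp mu|.

Definition mtheta (i : 'I_k) : IrrG := enum_val i.
Definition msize (i : 'I_k) : nat := sumn (mu (mtheta i)).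

Lemma sum_msize : (\sum_i msize i)%N = n.
Proof.
transitivity (\sum_(theta in msupp mu) sumn (mu theta))%N.
  by rewrite [RHS]big_enum_val.
case: mu_n => _ <-; rewrite [RHS](bigID (mem (msupp mu))) /=.
rewrite [X in (_ + X)%N]big1 ?addn0 //.
by move=> theta; rewrite !inE negbK => /eqP ->.
Qed.

Definition mblock : 'I_n -> 'I_k := block sum_msize.
Definition mdeg (i : 'I_k) : nat := irr_degree (mtheta i).

(* W_m = G^n ><| S_m *)
Definition wyoung_set : {set wreath G n} :=
  [set w | wperm w \in young sum_msize].

Lemma mem_wyoung w : (w \in wyoung_set) = (wperm w \in young sum_msize).
Proof. by rewrite inE. Qed.

Lemma wyoung_group_set : group_set wyoung_set.
Proof.
apply/group_setP; split=> [|u v]; first by rewrite mem_wyoung group1.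
by rewrite !mem_wyoung wpermM => Yu Yv; rewrite groupM.
Qed.
Canonical wyoung := Group wyoung_group_set.

(* A basis vector of theta_1^m_1 x .. x theta_k^m_k is a family x of basis
   vectors, x j being one of the representation attached to the block of j;
   a basis vector of theta_i is encoded as a pair (i, a) with a : 'I_(mdeg i). *)
Definition tensor_basis :=
  [set x : {ffun 'I_n -> {i : 'I_k & 'I_(mdeg i)}} | [forall j, tag (x j) == mblock j]].

Definition mentry (g : G) (u v : {i : 'I_k & 'I_(mdeg i)}) : C :=
  irr_repr (mtheta (tag u)) g (tagged u) (tagged_as u v).

(* (1; s) maps v_1 x .. x v_n to the tensor with j-th factor v_(s^-1 j). *)
Definition tensor_kernel (w : wreath G n)
    (x y : {ffun 'I_n -> {i : 'I_k & 'I_(mdeg i)}}) : C :=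
  \prod_j mentry (wbase w j) (x j) (y ((wperm w)^-1%g j)).

Lemma tensor_mx_repr : mx_repr wyoung (kernel_mx tensor_basis tensor_kernel).
Proof.
apply: kernel_mx_repr => [x y | u v Wu Wv x z].
  rewrite !inE => /'forall_eqP tx /'forall_eqP ty.
  rewrite /tensor_kernel; have [->|neq_xy] := eqVneq x y.
    apply: big1 => j _; rewrite wbase1 [wperm _]wperm1 invg1 perm1 /mentry.
    by case: (y j) => i a /=; rewrite tagged_asE repr_mx1 mxE eqxx.
  have [j neq_j] : exists j, x j != y j.
    by apply/existsP; apply: contraNT neq_xy => /existsPn eq_xy;
       apply/eqP/ffunP=> j; apply/eqP; rewrite -[_ == _]negbK eq_xy.
  rewrite (bigD1 j) // wbase1 [wperm _]wperm1 invg1 perm1 /mentry.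
  have: tag (x j) = tag (y j) by rewrite tx ty.
  move: neq_j; case: (x j) (y j) => [i a] [i' b] /= neq_ab eq_i.
  case: _ / eq_i in b neq_ab *; rewrite tagged_asE repr_mx1 mxE.
  by rewrite eq_Tagged /= in neq_ab; rewrite (negPf neq_ab) mul0r.
rewrite !inE => /'forall_eqP tx /'forall_eqP tz.
pose s := wperm u.
have Ys : s \in young sum_msize by rewrite -mem_wyoung.
have Yt : wperm v \in young sum_msize by rewrite -mem_wyoung.
have bV t j : t \in young sum_msize -> mblock (t^-1%g j) = mblock j.
  by rewrite -groupV => /youngP.
rewrite /tensor_kernel wpermM.
transitivity (\prod_j \sum_(b | tag b == mblock j)
    mentry (wbase u (s j)) (x (s j)) b
      * mentry (wbase v j) b (z ((wperm v)^-1%g j))).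
  rewrite (reindex_perm s) /=; apply: eq_bigr => j _.
  rewrite wbaseM invMg permM permK /mentry.
  have: tag (z ((wperm v)^-1%g j)) = mblock j by rewrite tz bV.
  have: tag (x (s j)) = mblock j by rewrite tx; apply: (youngP _ _ Ys).
  move: (z _) (x _) => [i a] [i' b] /= di' di.
  rewrite di in a *; rewrite di' in b *; rewrite !tagged_asE.
  rewrite repr_mxM ?inE // mxE.
  rewrite (reindex_onto (fun c => Tagged (fun i => 'I_(mdeg i)) c)
    (fun c => tagged_as (Tagged (fun i => 'I_(mdeg i)) a) c)) /=; last first.
    by case=> l c /= /eqP dl; case: _ / (esym dl) in c *; rewrite tagged_asE.
  apply: eq_big => [c | c _]; first by rewrite tagged_asE !eqxx.
  by rewrite !tagged_asE.
rewrite (bigA_distr_big_dep (fun j b => tag b == mblock j)) /=.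
apply: eq_big => [y | y _].
  by rewrite [RHS]inE; apply: eq_forallb => j.
rewrite big_split /=; congr (_ * _); rewrite (reindex_perm s^-1%g) /=.
by apply: eq_bigr => j _; rewrite permKV.
Qed.

Definition tensor_repr := MxRepresentation tensor_mx_repr.

Variable tau : forall i : 'I_k, representation C [set: 'S_(msize i)]%G.

Lemma block_mx_repr i :
  mx_repr (young sum_msize) (fun s => tau i (block_perm sum_msize i s)).
Proof.
split=> [|s t Ys Yt]; first by rewrite block_perm1 repr_mx1.
by rewrite block_permM // repr_mxM ?inE.
Qed.

(* The external tensor product of the tau i, as a representation of the
   internal direct product of the symmetric groups of the blocks. *)
Definition tau_young : representation C (young sum_msize) :=
  \big[@prod_grepr _ _ _/triv_grepr C _]_(i < k)
    Representation (MxRepresentation (block_mx_repr i)).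

(* The inverse turns wperm, which reverses products of permutations as
   multiplied in MathComp, into a morphism; it identifies S_n for composition
   with 'S_n. *)
Lemma tau_lift_mx_repr :
  mx_repr wyoung (fun w => tau_young (wperm w)^-1%g).
Proof.
split=> [|u v]; first by rewrite [wperm _]wperm1 invg1 repr_mx1.
by rewrite !mem_wyoung wpermM invMg => Yu Yv; rewrite repr_mxM ?groupV.
Qed.

Definition tau_lift := MxRepresentation tau_lift_mx_repr.

Definition rho_mu : mx_representation C [set: wreath G n]%G _ :=
  ind_repr (prod_repr tensor_repr tau_lift) (subsetT wyoung).

End RhoMu.

Definition is_rho_mu (mu : IrrG -> seq nat) (mu_n : is_multipartition mu)
    d (rho : mx_representation C [set: wreath G n]%G d) :=
  exists tau : forall i : 'I_#|msupp mu|, representation C [set: 'S_(msize i)]%G,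
    (forall i, is_specht (mu := mu (mtheta i)) erefl (tau i)) /\
    mx_rsim rho (rho_mu mu_n tau).

Definition Irr0 d (rho : mx_representation C [set: wreath G n]%G d) :=
  exists (mu : IrrG -> seq nat) (mu_n : is_multipartition mu),
    msupp mu = [set principal_comp Irr_index] /\ is_rho_mu mu_n rho.

End IrreducibleWreath.

(* Main.v *)
Require Import Defs.
From mathcomp Require Import all_classical all_reals ereal.
From mathcomp Require Import all_boot all_order all_algebra.
From mathcomp Require Import all_fingroup all_solvable all_field all_character.
From mathcomp Require Import complex.

Set Implicit Arguments.
Unset Strict Implicit.
Unset Printing Implicit Defensive.

Import Order.TTheory GRing.Theory Num.Theory.
Local Open Scope ring_scope.
Local Open Scope complex_scope.

(** For a vertex i let d_i be the sum of the weights c_B over the sets B that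
    contain i. The least d_i separates the two sides of the inequality.

    On an irreducible representation on which G^n acts nontrivially, every real
    eigenvalue x of the Laplacian is at least some d_i ([eigenvalue_ge_degree]).
    The average e_i over the i-th copy of G commutes with every J_B and satisfies
    e_i J_B = J_B when B contains i. Hence, if v is an eigenvector, so is
    u = v (1 - e_i) when it is nonzero, and J_B kills u for every B containing i.
    On u the Laplacian is therefore d_i plus the sum of the c_B (1 - J_B) over the
    B that avoid i, which only adds a nonnegative amount because each J_B
    contracts an invariant norm. If u = 0 for every i, then v is fixed by G^n, and
    so is the whole irreducible representation.

    Conversely, for every i that is not almost-isolated, the permutation
    representation on C^n has an eigenvector, orthogonal to the constants, with an
    eigenvalue smaller than d_i ([star_eigenvalue_lt_degree]). The diagonal entry
    of the Laplacian at i is the sum of the c_B (1 - 1/|B|) over the B containing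
    i, and the unit vector at i projected off the constants has squared norm
    1 - 1/n. Since |B| <= n, the Rayleigh quotient is at most d_i, and the
    inequality is strict as soon as c_B > 0 for some proper B containing i. Matrix
    coefficients carry this eigenvector into the nontrivial part of the regular
    representation ([avg_ker_eigenvalue]).

    It remains to see that the irreducible representations on which G^n acts
    trivially belong to Irr_0 ([base_triv_Irr0]). Such a representation comes
    from an irreducible representation tau of S_n, and tau is a Specht module for
    any mu maximal in the dominance order among the partitions for which tau
    occurs in M^mu ([irr_is_specht]). *)

(** * Isomorphisms and constituents of matrix representations *)

Section Generalities.

Variables (F : fieldType) (gT : finGroupType).
Implicit Types G H L : {group gT}.

Lemma mx_rsim_reindex G n1 n2 (r1 : mx_representation F G n1)
    (r2 : mx_representation F G n2) (f : 'I_n1 -> 'I_n2) :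
    bijective f ->
    {in G, forall g, forall i j, r1 g i j = r2 g (f i) (f j)} ->
  mx_rsim r1 r2.
Proof.
move=> bij_f eq_r; have [f' fK f'K] := bij_f.
have eqn : n1 = n2 by rewrite -[n1]card_ord -[n2]card_ord (bij_eq_card bij_f).
pose B : 'M[F]_(n1, n2) := \matrix_(i, j) (f i == j)%:R.
have BE n (A : 'M_(n2, n)) i j : (B *m A) i j = A (f i) j.
  rewrite mxE (bigD1 (f i)) //= big1 ?addr0 => [|k neq_k]; rewrite mxE.
    by rewrite eqxx mul1r.
  by rewrite eq_sym (negPf neq_k) mul0r.
exists B => // [|g Gg].
  apply/row_freeP; exists (\matrix_(i, j) (f' i == j)%:R).
  by apply/matrixP=> i j; rewrite BE !mxE fK.
apply/matrixP=> i j; rewrite BE -[j in RHS]f'K -eq_r // mxE.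
rewrite (bigD1 (f' j)) //= mxE f'K eqxx mulr1 big1 ?addr0 // => k neq_k.
by rewrite mxE -(inj_eq (can_inj f'K)) fK in neq_k *; rewrite (negPf neq_k) mulr0.
Qed.

Lemma ind_repr_full L H d (rho : mx_representation F H d) (sHL : H \subset L)
    (r : mx_representation F L d) :
    L \subset H -> {in L, forall g, r g = rho g} -> mx_rsim r (ind_repr rho sHL).
Proof.
move=> sLH eq_r; have eqLH : L = H :> {set gT} by apply/eqP; rewrite eqEsubset sLH.
have cosetH A : A \in rcosets H L -> A = H.
  by case/rcosetsP=> x Lx ->; rewrite rcoset_id // -eqLH.
have basis i : (H : {set gT}, i) \in ind_basis L H d.
  rewrite !inE /= andbT; apply/rcosetsP; exists 1%g => //.
  by rewrite rcoset_id.
have injb (a : 'I_#|ind_basis L H d|) : (enum_val a).1 = H.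
  by have := enum_valP a; rewrite !inE andbT => /cosetH.
pose f i := enum_rank_in (basis i) (H : {set gT}, i).
have fE i : enum_val (f i) = (H : {set gT}, i) by rewrite enum_rankK_in.
apply: (@mx_rsim_reindex _ _ _ _ _ f).
  exists (fun a => (enum_val a).2) => [i | a]; first by rewrite fE.
  by apply: enum_val_inj; rewrite fE -(injb a); case: (enum_val a).
move=> g Lg i j; rewrite mxE !fE /ind_kernel /= repr_group mul1g invg1 mulg1.
by rewrite (subsetP sLH) // eq_r.
Qed.

Lemma constituent_free G d1 (tau : mx_representation F G d1) d2
    (rho : mx_representation F G d2) (B : 'M_(d1, d2)) :
    row_free B -> {in G, forall g, tau g *m B = B *m rho g} ->
  constituent tau rho.
Proof.
move=> freeB homB; pose U : 'M_d2 := <<B>>%MS.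
have modU : mxmodule rho U.
  apply/mxmoduleP=> g Gg; rewrite !(eqmxMr _ (genmxE _)) genmxE -homB //.
  exact: submxMl.
have sBU : (B <= U)%MS by rewrite genmxE.
exists U, modU; exists (in_submod U B) => [||g Gg].
- by rewrite genmxE; apply/esym/eqP.
- by rewrite /row_free mxrank_in_submod.
by rewrite -in_submodJ // -homB //; apply: mulmxA.
Qed.

(** This is Frobenius reciprocity: the column c is an H-fixed linear form on tau,
    and its translates along the cosets of H are the coordinates of a map from tau
    to the induced representation. Irreducibility makes that map injective. *)
Lemma constituent_ind_triv L H d (sHL : H \subset L)
    (tau : mx_representation F L d) (c : 'cV_d) :
    mx_irreducible tau -> c != 0 -> {in H, forall h, tau h *m c = c} ->
  constituent tau (ind_repr (triv_grepr F H) sHL).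
Proof.
move=> irr_tau nz_c fix_c.
pose B : 'M[F]_(d, #|ind_basis L H 1|) :=
  \matrix_(i, a) (tau (repr (enum_val a).1)^-1%g *m c) i 0.
have basisE (a : 'I_#|ind_basis L H 1|) : (enum_val a).1 \in rcosets H L.
  by have := enum_valP a; rewrite !inE andbT.
have homB g : g \in L -> tau g *m B = B *m ind_repr (triv_grepr F H) sHL g.
  move=> Lg; apply/matrixP=> i a.
  have [LA defA] := repr_rcosets sHL (basisE a).
  set A := (enum_val a).1 in LA defA.
  (* In column A, only the coset C0 = A g^-1 contributes to the right-hand side. *)
  pose C0 := (H :* (repr A * g^-1))%g.
  have LC0 : C0 \in rcosets H L.
    by apply/rcosetsP; exists (repr A * g^-1)%g; rewrite ?groupM ?groupV.
  have C0b : (C0, 0) \in ind_basis L H 1 by rewrite !inE LC0.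
  pose c0 := enum_rank_in C0b (C0, 0).
  have c0E : enum_val c0 = (C0, 0) by rewrite enum_rankK_in.
  transitivity ((tau (g * (repr A)^-1)%g *m c) i 0).
    rewrite repr_mxM ?groupV // -mulmxA !mxE; apply: eq_bigr => k _.
    by rewrite mxE.
  rewrite [RHS]mxE (bigD1 c0) //= big1 ?addr0 => [|b neq_b].
    have [LC defC] := repr_rcosets sHL LC0.
    have Hz : (repr C0 * g * (repr A)^-1 \in H)%g.
      have := mem_repr_rcoset H (repr A * g^-1)%g.
      by rewrite mem_rcoset invMg invgK mulgA.
    have -> : ind_repr (triv_grepr F H) sHL g c0 a = 1.
      by rewrite mxE c0E /ind_kernel /= Hz !ord1 mxE.
    have -> : B i c0 = (tau (repr C0)^-1%g *m c) i 0 by rewrite mxE c0E.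
    have -> : ((repr C0)^-1 =
      (g * (repr A)^-1) * (repr C0 * g * (repr A)^-1)^-1)%g.
      by rewrite !invMg !invgK !mulgA mulgKV mulgV mul1g.
    have Lx : (g * (repr A)^-1)%g \in L by rewrite groupM ?groupV.
    have Lz := subsetP sHL _ Hz.
    move: (g * _)%g (_ * g * _)%g Lx Lz Hz => x z Lx Lz Hz.
    by rewrite mulr1 repr_mxM ?groupV // -mulmxA (fix_c z^-1%g) ?groupV.
  rewrite [kernel_mx _ _ _ _ _]mxE /ind_kernel; case: ifP => [Hz|_]; last first.
    by rewrite mulr0.
  case/eqP: neq_b; apply: enum_val_inj; rewrite c0E.
  rewrite [enum_val b]surjective_pairing; congr (_, _); last exact: ord1.
  have [LB defB] := repr_rcosets sHL (basisE b).
  rewrite defB; apply/rcoset_eqP; rewrite mem_rcoset invMg invgK mulgA.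
  exact: Hz.
have nzB : B != 0.
  have Hb : (H : {set gT}, 0) \in ind_basis L H 1.
    by rewrite !inE /= andbT; apply/rcosetsP; exists 1%g; rewrite ?rcoset_id.
  apply: contraNneq nz_c => B0; apply/eqP/matrixP=> i j; rewrite ord1.
  have /matrixP/(_ i (enum_rank_in Hb (H : {set gT}, 0))) := B0.
  rewrite [B _ _]mxE [X in _ = X -> _]mxE enum_rankK_in //= repr_group invg1.
  by rewrite repr_mx1 mul1mx mxE.
apply: (constituent_free _ homB).
have [d_gt0 irrU] := (mx_irrP tau).1 irr_tau.
rewrite -kermx_eq0; apply: contraR nzB => nz_ker.
have modK : mxmodule tau (kermx B).
  apply/mxmoduleP=> g Lg; apply/sub_kermxP.
  by rewrite -mulmxA homB // mulmxA mulmx_ker mul0mx.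
have := irrU _ modK nz_ker; rewrite -sub1mx => /sub_kermxP.
by rewrite mul1mx => ->.
Qed.

(** [tprod] is built by recursion on blocks; tensoring with a 1 x 1 matrix on the
    right keeps the values of the indices, though not their types. *)
Lemma trow_scalar n1 (A : 'rV[F]_n1) (B : 'M[F]_1) i (j : 'I_(n1 * 1))
    (j' : 'I_n1) :
  j = j' :> nat -> trow A B i j = A 0 j' * B 0 0.
Proof.
elim: n1 A j j' => [|n1 IH] A j j'; first by case: j'.
move=> eqj; rewrite /= !mxE; case: splitP => k eqk.
  have -> : j' = 0.
    by apply: val_inj; rewrite /= -eqj eqk; case: k {eqk} => [[]].
  rewrite !mxE !ord1; congr (A _ _ * _); exact: val_inj.
have lt_k : (k < n1)%N by rewrite -[ltnRHS]muln1.
rewrite (IH _ k (Ordinal lt_k)) // mxE; congr (A _ _ * _).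
by apply: val_inj; rewrite /= -eqj eqk.
Qed.

Lemma tprod_scalar m1 n1 (A : 'M[F]_(m1, n1)) (B : 'M[F]_1)
    (i : 'I_(m1 * 1)) (j : 'I_(n1 * 1)) (i' : 'I_m1) (j' : 'I_n1) :
  i = i' :> nat -> j = j' :> nat -> tprod A B i j = A i' j' * B 0 0.
Proof.
elim: m1 A i i' => [|m1 IH] A i i'; first by case: i'.
move=> eqi eqj; rewrite /= mxE; case: splitP => k eqk.
  have -> : i' = 0.
    by apply: val_inj; rewrite /= -eqi eqk; case: k {eqk} => [[]].
  rewrite (trow_scalar _ _ _ eqj) !mxE; congr (A _ _ * _); exact: val_inj.
have lt_k : (k < m1)%N by rewrite -[ltnRHS]muln1.
rewrite (IH _ _ (Ordinal lt_k)) // mxE; congr (A _ _ * _).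
by apply: val_inj; rewrite /= -eqi eqk.
Qed.

Lemma mx_rsim_prod_triv_r G d (r : mx_representation F G d)
    (t : mx_representation F G 1) :
  {in G, forall g, t g = 1%:M} -> mx_rsim r (prod_repr r t).
Proof.
move=> t1; apply: (@mx_rsim_reindex _ _ _ _ _ (cast_ord (esym (muln1 d)))).
  by exists (cast_ord (muln1 d)); [exact: cast_ordKV | exact: cast_ordK].
move=> g Gg i j; rewrite (@tprod_scalar _ _ (r g) (t g) _ _ i j) //.
by rewrite t1 // mxE mulr1.
Qed.

Lemma mx_rsim_prod_triv_l G m d (r : mx_representation F G d)
    (t : mx_representation F G m) :
  m = 1%N -> {in G, forall g, t g = 1%:M} -> mx_rsim r (prod_repr t r).
Proof.
move=> m1; subst m => t1.
apply: (@mx_rsim_reindex _ _ _ _ _ (cast_ord (esym (mul1n d)))).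
  by exists (cast_ord (mul1n d)); [exact: cast_ordKV | exact: cast_ordK].
move=> g Gg i j; rewrite prod_repr_lin // castmxE !cast_ordK.
by rewrite t1 // !mxE mul1r.
Qed.

Lemma mx_rsim_big_prod1 G k (r : 'I_k -> representation F G) i :
  k = 1%N -> mx_rsim (r i) (\big[@prod_grepr _ _ _/triv_grepr F G]_(j < k) r j).
Proof.
move=> k1; subst k; rewrite big_ord_recl big_ord0 ord1.
exact: mx_rsim_prod_triv_r.
Qed.

End Generalities.

(** * Labelling the irreducible representations of the symmetric group *)

Section SymmetricGroup.

Variable F : fieldType.

Lemma young_nseq1 n (e : sumn (nseq n 1%N) = n) (s : 'S_n) :
  s \in young (sum_nth_sumn e) -> s = 1%g.
Proof.
move=> /youngP Ys; apply/permP=> j; rewrite perm1.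
apply: (can_inj (block_sigK (sum_nth_sumn e))).
have := Ys j; rewrite /block.
case: (block_sig _ _) (block_sig _ j) => [r a] [r' a'] /= eqr.
subst r'; congr existT.
have le1 : (nth 0%N (nseq n 1%N) r <= 1)%N by rewrite nth_nseq; case: ifP.
apply: ord_inj; have := leq_trans (ltn_ord a) le1.
by have := leq_trans (ltn_ord a') le1; rewrite !ltnS !leqn0 => /eqP -> /eqP ->.
Qed.

Lemma sumn_nseq1 n : sumn (nseq n 1%N) = n.
Proof. by rewrite sumn_nseq mul1n. Qed.

(** The Young subgroup of type (1, .., 1) is trivial, so the representation induced
    from it is the regular one and every linear form on tau is fixed by it. *)
Lemma constituent_young_nseq1 n d (tau : mx_representation F [set: 'S_n]%G d) :
  mx_irreducible tau -> constituent tau (young_perm_repr F (sumn_nseq1 n)).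
Proof.
move=> irr_tau; have [d_gt0 _] := (mx_irrP tau).1 irr_tau.
apply: (@constituent_ind_triv _ _ _ _ _ _ _ (const_mx 1)) => //.
  apply/eqP=> /matrixP/(_ (Ordinal d_gt0) 0); rewrite !mxE.
  by apply/eqP/oner_neq0.
by move=> s /young_nseq1 ->; rewrite repr_mx1 mul1mx.
Qed.

Lemma is_partition_nseq1 n : is_partition (nseq n 1%N).
Proof.
apply/andP; split; last by rewrite mem_nseq andbF.
by case: n => //= n; elim: n => //= n ->.
Qed.

Lemma leq_sumn_take k (s : seq nat) : (sumn (take k s) <= sumn s)%N.
Proof. by rewrite -{2}(cat_take_drop k s) sumn_cat leq_addr. Qed.

Lemma size_partition (s : seq nat) : 0%N \notin s -> (size s <= sumn s)%N.
Proof.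
elim: s => //= x s IH; rewrite inE negb_or eq_sym -lt0n => /andP[x_gt0 /IH le_s].
by rewrite -add1n leq_add.
Qed.

Lemma sumn_takeS k (s : seq nat) :
  sumn (take k.+1 s) = (sumn (take k s) + nth 0 s k)%N.
Proof.
have [lt_ks | le_sk] := ltnP k (size s).
  by rewrite (take_nth 0%N lt_ks) sumn_rcons.
by rewrite !take_oversize ?nth_default ?addn0 // (leq_trans le_sk).
Qed.

Lemma eq_partition (s t : seq nat) : 0%N \notin s -> 0%N \notin t ->
  (forall k, nth 0%N s k = nth 0%N t k) -> s = t.
Proof.
elim: s t => [|x s IH] [|y t] //=.
- by rewrite inE negb_or eq_sym => _ /andP[/eqP nz _] /(_ 0%N) /= /esym.
- by rewrite inE negb_or eq_sym => /andP[/eqP nz _] _ /(_ 0%N).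
rewrite !inE !negb_or => /andP[_ s0] /andP[_ t0] eq_st.
by rewrite [x](eq_st 0%N) (IH t) // => k; apply: (eq_st k.+1).
Qed.

Definition partial_sums (n : nat) (s : seq nat) :=
  (\sum_(k < n.+1) sumn (take k s))%N.

(** The sum of the partial sums is a strictly monotone statistic for the
    dominance order. *)
Lemma dominates_partial_sums n (la mu : seq nat) :
    0%N \notin la -> 0%N \notin mu -> sumn la = n -> sumn mu = n ->
    dominates la mu -> (partial_sums n la <= partial_sums n mu)%N ->
  la = mu.
Proof.
move=> la0 mu0 ela emu dom le_sums.
have eq_take (k : 'I_n.+1) : sumn (take k la) = sumn (take k mu).
  have := leqif_sum (fun (k : 'I_n.+1) (_ : true) => leqif_eq (dom k)).
  case=> _ /esym; rewrite -/(partial_sums _ _) -/(partial_sums _ _).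
  rewrite eqn_leq le_sums andbT leq_sum // => /forallP/(_ k)/eqP -> //.
apply: eq_partition => // k; have [lt_kn | le_nk] := ltnP k n.
  have := eq_take (Ordinal (lt_kn : k.+1 < n.+1)%N); rewrite /= !sumn_takeS.
  by rewrite (eq_take (Ordinal (ltnW lt_kn : k < n.+1)%N)) => /addnI.
rewrite !nth_default // (leq_trans _ le_nk) //.
  by rewrite -emu size_partition.
by rewrite -ela size_partition.
Qed.

(** Among the partitions mu for which tau occurs in M^mu, one that is maximal for
    the dominance order labels tau; some mu occurs because M^(1,..,1) is the
    regular representation. *)
Lemma irr_is_specht n d (tau : mx_representation F [set: 'S_n]%G d) :
  mx_irreducible tau ->
  exists (mu : seq nat) (e : sumn mu = n), is_partition mu /\ is_specht e tau.
Proof.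
move=> irr_tau.
pose P N := `[< exists (mu : seq nat) (e : sumn mu = n),
  [/\ is_partition mu, constituent tau (young_perm_repr F e)
    & partial_sums n mu = N] >].
have exP : exists N, P N.
  exists (partial_sums n (nseq n 1%N)); apply/asboolP.
  exists (nseq n 1%N), (sumn_nseq1 n); split=> //.
    exact: is_partition_nseq1.
  exact: constituent_young_nseq1.
have leP N : P N -> (N <= n.+1 * n)%N.
  case/asboolP=> mu [e [_ _ <-]]; rewrite -[n.+1 in leqRHS]card_ord -sum_nat_const.
  by apply: leq_sum => k _; rewrite -[leqRHS]e leq_sumn_take.
have [N /asboolP[mu [e [mu_part tau_mu defN]]] maxN] := ex_maxnP exP leP.
exists mu, e; split=> //; split=> // la e' la_part dom neq_la tau_la.
apply: neq_la; case/andP: la_part (la_part) => _ la0 la_part; case/andP: mu_part => _ mu0.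
apply: (@dominates_partial_sums n) => //; rewrite defN; apply: maxN.
by apply/asboolP; exists la, e'.
Qed.

End SymmetricGroup.

(** * Representations that are trivial on the base group *)

Section CastRepr.

Variable F : fieldType.

(** The block sizes of a multi-partition with a single nonempty part equal n only
    propositionally, hence this transport. *)
Definition cast_repr n m d (e : n = m)
    (tau : mx_representation F [set: 'S_n]%G d) :
    mx_representation F [set: 'S_m]%G d :=
  let: erefl := e in tau.

Lemma cast_reprE n m d (e : n = m) (tau : mx_representation F [set: 'S_n]%G d) s :
  cast_repr e tau s = tau (cast_perm (esym e) s).
Proof. by case: m / e s => s; rewrite cast_perm_id. Qed.

Lemma cast_repr_specht n m d (e : n = m) (tau : mx_representation F [set: 'S_n]%G d)
    (mu nu : seq nat) (emu : sumn mu = n) (enu : sumn nu = m) :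
  nu = mu -> is_specht emu tau -> is_specht enu (cast_repr e tau).
Proof.
by case: m / e enu => enu eq_nu; subst nu; rewrite (eq_irrelevance enu emu).
Qed.

End CastRepr.

Section TrivialBase.

Variables (C : decFieldType) (G : finGroupType) (n d : nat).
Variable rho : mx_representation C [set: wreath G n]%G d.

Local Notation IrrG := (socle_sort (Irr_index C G)).

(** The inverse is needed because [wperm] reverses products. *)
Lemma perm_part_mx_repr :
  mx_repr [set: 'S_n]%G (fun s => rho (Wreath [ffun=> 1%g] s^-1%g)).
Proof.
split=> [|s t _ _]; first by rewrite invg1; exact: (repr_mx1 rho).
rewrite -repr_mxM ?inE //; congr (rho _); congr Wreath; last by rewrite invMg.
by apply/ffunP=> i; rewrite !ffunE mulg1.
Qed.
Definition perm_part := MxRepresentation perm_part_mx_repr.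

Hypothesis base_triv : forall g, rho (Wreath g 1%g) = 1%:M.

Lemma rho_perm_part w : rho w = perm_part (wperm w)^-1%g.
Proof.
rewrite /= invgK.
have -> : w = (Wreath (wbase w) 1 * Wreath [ffun=> 1] (wperm w))%g.
  case: w => g s; congr Wreath; last by rewrite /= mulg1.
  by apply/ffunP=> i; rewrite !ffunE mulg1.
by rewrite repr_mxM ?inE // base_triv mul1mx wpermM /= mulg1.
Qed.

Lemma perm_part_irr : mx_irreducible rho -> mx_irreducible perm_part.
Proof.
move=> /mx_irrP[d_gt0 irr]; apply/mx_irrP; split=> // U modU; apply: irr.
apply/mxmoduleP=> w _; rewrite rho_perm_part.
by apply: (mxmoduleP modU); rewrite inE.
Qed.

Section OneRow.

Variable mu : seq nat.
Hypotheses (mu_part : is_partition mu) (mu_n : sumn mu = n) (n_gt0 : (0 < n)%N).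

Definition triv_multi (theta : IrrG) : seq nat :=
  if theta == principal_comp (Irr_index C G) then mu else [::].

Lemma triv_multiP : is_multipartition n triv_multi.
Proof.
split=> [theta|]; first by rewrite /triv_multi; case: ifP.
rewrite (bigD1 (principal_comp (Irr_index C G))) //= /triv_multi eqxx mu_n.
by rewrite big1 ?addn0 // => theta /negPf ->.
Qed.

Lemma msupp_triv : msupp triv_multi = [set principal_comp (Irr_index C G)].
Proof.
have nz_mu : mu != [::] by apply/eqP=> mu0; move: n_gt0; rewrite -mu_n mu0.
by apply/setP=> theta; rewrite !inE /triv_multi; case: ifP; rewrite ?nz_mu ?eqxx.
Qed.

Lemma card_msupp_triv : #|msupp triv_multi| = 1%N.
Proof. by rewrite msupp_triv cards1. Qed.

Lemma mtheta_triv (i : 'I_#|msupp triv_multi|) :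
  mtheta i = principal_comp (Irr_index C G).
Proof. by apply/set1P; rewrite -msupp_triv; apply: enum_valP. Qed.

Lemma mpart_triv (i : 'I_#|msupp triv_multi|) : triv_multi (mtheta i) = mu.
Proof. by rewrite /triv_multi mtheta_triv eqxx. Qed.

Lemma msize_triv (i : 'I_#|msupp triv_multi|) : msize i = n.
Proof. by rewrite /msize mpart_triv. Qed.

Lemma tensor_index_eq (u v : {i : 'I_#|msupp triv_multi| & 'I_(mdeg i)}) : u = v.
Proof.
case: u v => [i x] [j y]; have eqij : i = j.
  by apply: enum_val_inj; rewrite -!/(mtheta _) !mtheta_triv.
subst j; congr existT; apply: ord_inj.
have : mdeg i = 1%N by rewrite /mdeg mtheta_triv degree_irr1.
by case: (mdeg i) x y => [[]|[|]] // x y _; rewrite !ord1.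
Qed.

Lemma mentry_triv g (u v : {i : 'I_#|msupp triv_multi| & 'I_(mdeg i)}) :
  mentry g u v = 1.
Proof.
rewrite (tensor_index_eq v u); case: u => i x; rewrite /mentry tagged_asE.
change (irr_repr (mtheta i) g x x = 1); move: x; rewrite /mdeg mtheta_triv => x.
by rewrite irr1_repr ?inE // mxE eqxx.
Qed.

Lemma tensor_repr_triv : {in wyoung triv_multiP, forall w,
  tensor_repr triv_multiP w = 1%:M}.
Proof.
move=> w Yw; apply/matrixP=> a b; rewrite mxE [RHS]mxE.
have -> : a = b by apply: enum_val_inj; apply/ffunP=> j; apply: tensor_index_eq.
by rewrite eqxx; apply: big1 => j _; apply: mentry_triv.
Qed.

Lemma card_tensor_basis : #|tensor_basis triv_multiP| = 1%N.
Proof.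
pose x0 := [ffun j => Tagged (fun i : 'I_#|msupp triv_multi| => 'I_(mdeg i))
  (Ordinal (irr_degree_gt0 (mtheta (mblock triv_multiP j))))].
suff -> : tensor_basis triv_multiP = [set x0] by rewrite cards1.
apply/setP=> x; have -> : x = x0 by apply/ffunP=> j; apply: tensor_index_eq.
by rewrite !inE eqxx; apply/forallP=> j; rewrite ffunE.
Qed.

Definition triv_tau (i : 'I_#|msupp triv_multi|) :
    representation C [set: 'S_(msize i)]%G :=
  Representation (cast_repr (esym (msize_triv i)) perm_part).

Lemma block_rank_triv (i : 'I_#|msupp triv_multi|) (a : 'I_(msize i)) :
  block_rank (sum_msize triv_multiP) (Tagged (fun i => 'I_(msize i)) a)
    = cast_ord (msize_triv i) a.
Proof.
apply: ord_inj; apply: etrans (tagnat.rankEsum _) _; rewrite /= big_pred0 // => j.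
apply/negbTE; rewrite -leqNgt -ltnS (leq_trans (ltn_ord i)) //.
by rewrite [leqLHS]card_msupp_triv.
Qed.

Lemma triv_tauE (i : 'I_#|msupp triv_multi|) s :
    s \in young (sum_msize triv_multiP) ->
  triv_tau i (block_perm (sum_msize triv_multiP) i s) = perm_part s.
Proof.
move=> Ys; rewrite [LHS]cast_reprE; congr (perm_part _).
apply/permP=> j; rewrite cast_permE.
rewrite esymK -block_rank_triv block_permE // block_sigK block_rank_triv.
by rewrite cast_ordKV.
Qed.

(** With a single block the Young subgroup is the whole symmetric group, so that
    the induction is void, the tensor power of the trivial representation of G is
    trivial, and the product over the blocks has one factor. *)
Lemma rho_mu_triv : mx_rsim rho (rho_mu triv_multiP triv_tau).
Proof.
have i0 : 'I_#|msupp triv_multi| by rewrite card_msupp_triv; exact: ord0.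
have allY s : s \in young (sum_msize triv_multiP).
  apply/youngP=> j; apply: enum_val_inj.
  exact: etrans (mtheta_triv _) (esym (mtheta_triv _)).
have sTW : [set: wreath G n] \subset wyoung triv_multiP.
  by apply/subsetP=> w _; rewrite mem_wyoung allY.
pose prodW := prod_repr (tensor_repr triv_multiP) (tau_lift triv_multiP triv_tau).
apply: mx_rsim_trans (ind_repr_full (rho := prodW) (subsetT _) sTW
  (r := subg_repr prodW sTW) _) => //.
have [B eqd freeB homB] : mx_rsim (tau_lift triv_multiP triv_tau) prodW.
  by apply: mx_rsim_prod_triv_l; [exact: card_tensor_basis | exact: tensor_repr_triv].
have [B' eqd' freeB' homB'] := mx_rsim_big_prod1
  (fun i => Representation (MxRepresentation
     (block_mx_repr triv_multiP triv_tau i))) i0 card_msupp_triv.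
apply: (@mx_rsim_trans _ _ _ _ _ _ _ (subg_repr (tau_lift triv_multiP triv_tau) sTW)).
  exists B' => // w _; rewrite rho_perm_part -(triv_tauE i0) ?allY //.
  exact: homB'.
by exists B => // w _; apply: homB; rewrite mem_wyoung allY.
Qed.

End OneRow.

(** The multi-partition is the one supported at the trivial representation of G,
    with value the label of the representation of the symmetric group. *)
Lemma base_triv_Irr0 : (0 < n)%N -> mx_irreducible rho -> Irr0 rho.
Proof.
move=> n_gt0 irr_rho.
have [mu [e [mu_part mu_tau]]] := irr_is_specht (perm_part_irr irr_rho).
exists (triv_multi mu), (triv_multiP mu_part e); split; first exact: msupp_triv.
exists (triv_tau e n_gt0); split; last exact: rho_mu_triv.
move=> i; apply: cast_repr_specht mu_tau.
exact: mpart_triv.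
Qed.

End TrivialBase.

(** * Averages over subgroups and an invariant norm *)

Section Average.

Variables (F : numFieldType) (gT : finGroupType) (G : {group gT}).
Variables (d : nat) (rho : mx_representation F G d).
Implicit Types A B : {set gT}.

Definition avg_mx A : 'M[F]_d := #|A|%:R^-1 *: \sum_(g in A) rho g.

Lemma card_group_neq0 (H : {group gT}) : #|H|%:R != 0 :> F.
Proof. by rewrite pnatr_eq0 -lt0n cardG_gt0. Qed.

Lemma repr_avg_mx (H : {group gT}) h : H \subset G -> h \in H ->
  rho h *m avg_mx H = avg_mx H.
Proof.
move=> sHG Hh; rewrite -scalemxAr mulmx_sumr; congr (_ *: _).
rewrite [RHS](reindex_inj (mulgI h)) /=.
by apply: eq_big => [g|g Hg]; rewrite ?groupMl // repr_mxM ?(subsetP sHG).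
Qed.

Lemma avg_mx_repr (H : {group gT}) h : H \subset G -> h \in H ->
  avg_mx H *m rho h = avg_mx H.
Proof.
move=> sHG Hh; rewrite -scalemxAl mulmx_suml; congr (_ *: _).
rewrite [RHS](reindex_inj (mulIg h)) /=.
by apply: eq_big => [g|g Hg]; rewrite ?groupMr // repr_mxM ?(subsetP sHG).
Qed.

Lemma avg_mx_fix (H : {group gT}) m (A : 'M_(m, d)) :
  {in H, forall h, A *m rho h = A} -> A *m avg_mx H = A.
Proof.
move=> fixA; rewrite -scalemxAr mulmx_sumr (eq_bigr (fun _ => A)) //.
by rewrite sumr_const -scaler_nat scalerA mulVf ?scale1r ?card_group_neq0.
Qed.

Lemma fix_avg_mx (H : {group gT}) m (A : 'M_(d, m)) :
  {in H, forall h, rho h *m A = A} -> avg_mx H *m A = A.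
Proof.
move=> fixA; rewrite -scalemxAl mulmx_suml (eq_bigr (fun _ => A)) //.
by rewrite sumr_const -scaler_nat scalerA mulVf ?scale1r ?card_group_neq0.
Qed.

Lemma avg_mxC A B : A \subset G -> B \subset G ->
  {in A & B, forall a b, (a * b = b * a)%g} ->
  avg_mx A *m avg_mx B = avg_mx B *m avg_mx A.
Proof.
move=> sAG sBG cAB; rewrite /avg_mx -!scalemxAl -!scalemxAr !scalerA mulrC.
congr (_ *: _); rewrite mulmx_suml mulmx_sumr; apply: eq_bigr => a Aa.
rewrite mulmx_suml mulmx_sumr; apply: eq_bigr => b Bb.
by rewrite -!repr_mxM ?(subsetP sAG a) ?(subsetP sBG b) // cAB.
Qed.

(** The l^1 norm summed over the orbit. It is invariant under G and subadditive,
    so averages over subgroups are contractions ([orbit_norm_avg]); the positivity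
    of 1 - J_B enters in this form. *)
Definition orbit_norm m (u : 'M[F]_(m, d)) : F :=
  \sum_(g in G) \sum_i \sum_j `|(u *m rho g) i j|.

Lemma orbit_norm_repr m (u : 'M_(m, d)) g : g \in G ->
  orbit_norm (u *m rho g) = orbit_norm u.
Proof.
move=> Gg; rewrite /orbit_norm [RHS](reindex_inj (mulgI g)) /=.
apply: eq_big => [h|h Gh]; first by rewrite groupMl.
by rewrite -mulmxA -repr_mxM.
Qed.

Lemma orbit_normZ m c (u : 'M_(m, d)) :
  orbit_norm (c *: u) = `|c| * orbit_norm u.
Proof.
rewrite /orbit_norm mulr_sumr; apply: eq_bigr => g _.
rewrite mulr_sumr; apply: eq_bigr => i _; rewrite mulr_sumr.
by apply: eq_bigr => j _; rewrite -scalemxAl mxE normrM.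
Qed.

Lemma orbit_norm_sum m I (r : seq I) (P : pred I) (u : I -> 'M_(m, d)) :
  orbit_norm (\sum_(k <- r | P k) u k) <= \sum_(k <- r | P k) orbit_norm (u k).
Proof.
rewrite /orbit_norm [leRHS]exchange_big; apply: ler_sum => g _.
rewrite [leRHS]exchange_big; apply: ler_sum => i _; rewrite [leRHS]exchange_big.
by apply: ler_sum => j _; rewrite mulmx_suml summxE ler_norm_sum.
Qed.

Lemma orbit_norm_ge0 m (u : 'M_(m, d)) : 0 <= orbit_norm u.
Proof. by do 3! [apply: sumr_ge0 => ? _]. Qed.

Lemma orbit_norm_gt0 m (u : 'M_(m, d)) : u != 0 -> 0 < orbit_norm u.
Proof.
move=> nz_u; rewrite lt_def orbit_norm_ge0 andbT; apply: contraNneq nz_u.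
move/eqP; rewrite psumr_eq0 => [|g _]; last by do 2! [apply: sumr_ge0 => ? _].
move/allP/(_ 1%g (mem_index_enum _)); rewrite group1 /= => /eqP.
move/eqP; rewrite psumr_eq0 => [/allP u0|i _]; last exact: sumr_ge0.
apply/eqP/matrixP=> i j; have /eqP := u0 i (mem_index_enum _).
move/eqP; rewrite psumr_eq0 // => /allP/(_ j (mem_index_enum _)).
by rewrite normr_eq0 repr_mx1 mulmx1 mxE => /eqP.
Qed.

Lemma orbit_norm_avg m (u : 'M_(m, d)) (H : {group gT}) : H \subset G ->
  orbit_norm (u *m avg_mx H) <= orbit_norm u.
Proof.
move=> sHG; rewrite -scalemxAr orbit_normZ mulmx_sumr normfV normr_nat.
rewrite ler_pdivrMl ?ltr0n ?cardG_gt0 //.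
apply: le_trans (orbit_norm_sum _ _ _) _.
rewrite (eq_bigr (fun _ => orbit_norm u)) => [|h Hh].
  by rewrite sumr_const mulr_natl.
by rewrite orbit_norm_repr // (subsetP sHG).
Qed.

End Average.

(** * The lower bound on representations nontrivial on the base group *)

Section WreathSubgroups.

Variables (G : finGroupType) (n : nat).
Local Notation W := (wreath G n).

Lemma wreath_subP (B : {set 'I_n}) (w : W) :
  reflect (forall i, i \notin B -> wperm w i = i /\ wbase w i = 1%g)
          (w \in wreath_sub G B).
Proof.
rewrite inE; apply: (iffP forall_inP) => fixw i /fixw.
  by case/andP=> /eqP-> /eqP->.
by case=> -> ->; rewrite !eqxx.
Qed.

Lemma wreath_sub_group_set (B : {set 'I_n}) : group_set (wreath_sub G B).
Proof.
apply/group_setP; split=> [|u v /wreath_subP fixu /wreath_subP fixv].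
  by apply/wreath_subP=> i _; rewrite wbase1 wperm1 perm1.
apply/wreath_subP=> i B'i; have [ui gi] := fixu i B'i; have [vi hi] := fixv i B'i.
rewrite wpermM permM vi ui wbaseM gi mul1g; split=> //.
by rewrite -{1}ui permK.
Qed.
Canonical wreath_sub_group (B : {set 'I_n}) := Group (wreath_sub_group_set B).

Lemma wreath_subS (A B : {set 'I_n}) :
  A \subset B -> wreath_sub G A \subset wreath_sub G B.
Proof.
move=> sAB; apply/subsetP=> w /wreath_subP fixw; apply/wreath_subP=> i B'i.
by apply: fixw; apply: contra B'i; apply: (subsetP sAB).
Qed.

Lemma wreath_sub1P i (w : W) :
  w \in wreath_sub G [set i] -> wperm w = 1%g /\ forall j, j != i -> wbase w j = 1%g.
Proof.
move=> /wreath_subP fixw; split=> [|j neq_ji]; last by case: (fixw j); rewrite ?inE.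
have fixw' j : j != i -> wperm w j = j by move=> nji; case: (fixw j); rewrite ?inE.
apply/permP=> j; rewrite perm1; have [->|/fixw' //] := eqVneq j i.
by have [//|/fixw'/perm_inj] := eqVneq (wperm w i) i.
Qed.

Lemma wreath_sub_comm i (B : {set 'I_n}) : i \notin B ->
  {in wreath_sub G [set i] & wreath_sub G B, forall u v, (u * v = v * u)%g}.
Proof.
move=> B'i u v /wreath_sub1P[pu gu] /wreath_subP fixv.
have [vi hi] := fixv i B'i.
case: u v pu gu vi hi {fixv} => [g s] [h t] /= -> gu ti hi.
congr Wreath; last by rewrite /= mul1g mulg1.
have tVi : t^-1%g i = i by rewrite -[in LHS]ti permK.
apply/ffunP=> j; rewrite !ffunE /= invg1 perm1.
have [->|neq_ji] := eqVneq j i; first by rewrite tVi hi mulg1 mul1g.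
rewrite (gu j) // (gu (t^-1%g j)) ?mulg1 ?mul1g //.
by apply: contra neq_ji => /eqP eq_i; rewrite -ti -eq_i permKV.
Qed.

Definition base_set : {set W} := [set w | wperm w == 1%g].

Lemma base_normal : (base_set <| [set: W])%g.
Proof.
apply/andP; split; first exact: subsetT.
apply/subsetP=> x _; rewrite inE; apply/subsetP=> _ /imsetP[w Bw ->].
move: Bw; rewrite !inE conjgE !wpermM => /eqP->.
by rewrite mulg1 -wpermM mulVg.
Qed.

(** The coordinate subgroups generate the base group: an element is the product of
    its components, multiplied in one at a time. *)
Lemma base_sub (H : {group W}) :
  (forall i, wreath_sub G [set i] \subset H) -> base_set \subset H.
Proof.
move=> sWH; apply/subsetP=> -[g s]; rewrite inE /= => /eqP->.
pose trunc k : W := Wreath [ffun i : 'I_n => if (i < k)%N then g i else 1%g] 1%g.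
have -> : Wreath g 1%g = trunc n.
  by congr Wreath; apply/ffunP=> i; rewrite ffunE ltn_ord.
suff mem_trunc k : (k <= n)%N -> trunc k \in H by apply: mem_trunc.
elim: k => [|k IH] lt_kn.
  suff -> : trunc 0%N = wreath_one G n by apply: group1.
  by congr Wreath; apply/ffunP=> i; rewrite !ffunE.
pose i := Ordinal lt_kn.
pose w : W := Wreath [ffun j => if j == i then g i else 1%g] 1%g.
rewrite (_ : trunc k.+1 = wreath_mul (trunc k) w); last first.
  congr Wreath; last by rewrite /= mulg1.
  apply/ffunP=> j; rewrite !ffunE /= invg1 perm1 -val_eqE /= ltnS leq_eqVlt.
  have [eq_jk | neq_jk] := eqVneq (val j) k; last by rewrite mulg1.
  by rewrite eq_jk ltnn mul1g; congr (g _); apply: val_inj.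
rewrite groupM ?IH ?(ltnW lt_kn) // (subsetP (sWH i)) //.
by apply/wreath_subP=> j; rewrite inE ffunE /= perm1 => /negPf->.
Qed.

End WreathSubgroups.

Section LowerBound.

Variables (R : realType) (G : finGroupType) (n : nat) (Gamma : whypergraph R n).
Variables (d : nat) (rho : mx_representation R[i] [set: wreath G n]%G d).
Local Notation J B := (avg_mx rho (wreath_sub G B)).

Lemma gring_op_laplacian :
  gring_op rho (laplacian G Gamma)
    = \sum_(B : {set 'I_n}) (Gamma B)%:C *: (1%:M - J B).
Proof.
rewrite /laplacian linear_sum; apply: eq_bigr => B _.
rewrite linearZ linearB /= gring_op1; congr (_ *: (_ - _)).
rewrite linearZ /gset_mx linear_sum /=; congr (_ *: _).
by apply: eq_bigr => w _; rewrite gring_opG ?inE.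
Qed.

Definition degree (i : 'I_n) : R := \sum_(B : {set 'I_n} | i \in B) Gamma B.

Lemma J1_laplacianC i :
  J [set i] *m gring_op rho (laplacian G Gamma)
    = gring_op rho (laplacian G Gamma) *m J [set i].
Proof.
rewrite gring_op_laplacian mulmx_sumr mulmx_suml; apply: eq_bigr => B _.
rewrite -scalemxAr -[RHS]scalemxAl mulmxBr mulmxBl mulmx1 mul1mx.
congr (_ *: (_ - _)); have [Bi | B'i] := boolP (i \in B).
  have sub : wreath_sub G [set i] \subset wreath_sub G B.
    by apply: wreath_subS; rewrite sub1set.
  rewrite fix_avg_mx => [|h Hh]; last first.
    exact: repr_avg_mx (subsetT _) (subsetP sub _ Hh).
  rewrite avg_mx_fix // => h Hh.
  exact: avg_mx_repr (subsetT _) (subsetP sub _ Hh).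
exact: avg_mxC (subsetT _) (subsetT _) (wreath_sub_comm B'i).
Qed.

Lemma J1_absorb i (B : {set 'I_n}) : i \in B -> J [set i] *m J B = J B.
Proof.
move=> Bi; have sub : wreath_sub G [set i] \subset wreath_sub G B.
  by apply: wreath_subS; rewrite sub1set.
rewrite fix_avg_mx // => h Hh.
exact: repr_avg_mx (subsetT _) (subsetP sub _ Hh).
Qed.

(** The sets B containing i contribute exactly d_i on u. With S the total weight of
    the other sets, u is an eigenvector of the sum of the c_B J_B over these sets,
    for the eigenvalue S - (x - d_i), which is at most S since each J_B is a
    contraction. *)
Lemma degree_le_eigenvalue i (u : 'rV_d) x :
    u != 0 -> u *m J [set i] = 0 ->
    u *m gring_op rho (laplacian G Gamma) = x%:C *: u ->
  degree i <= x.
Proof.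
move=> nz_u uJ0 ux; pose S := \sum_(B : {set 'I_n} | i \notin B) Gamma B.
pose y := x - degree i.
have uJ (B : {set 'I_n}) : i \in B -> u *m J B = 0.
  by move=> Bi; rewrite -(J1_absorb Bi) mulmxA uJ0 mul0mx.
have eqS : (S - y)%:C *: u = \sum_(B : {set 'I_n} | i \notin B) (Gamma B)%:C *: (u *m J B).
  have : (x - degree i - S)%:C *: u
      = - \sum_(B : {set 'I_n} | i \notin B) (Gamma B)%:C *: (u *m J B).
    rewrite !rmorphB !scalerBl -ux gring_op_laplacian mulmx_sumr.
    rewrite (bigID (fun B : {set 'I_n} => i \in B)) /=.
    rewrite /degree rmorph_sum scaler_suml /S rmorph_sum scaler_suml.
    rewrite (eq_bigr (fun B => (Gamma B)%:C *: u)) => [|B Bi]; last first.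
      by rewrite -scalemxAr mulmxBr mulmx1 uJ // subr0.
    rewrite [X in X - _ - _]addrC addrK -sumrB -sumrN; apply: eq_bigr => B _.
    by rewrite -scalemxAr mulmxBr mulmx1 scalerBr addrC addKr.
  move/(congr1 -%R); rewrite opprK -scaleNr -rmorphN => <-.
  by congr (_ *: u); rewrite [in RHS]opprB.
have: `|(S - y)%:C| * orbit_norm rho u <= S%:C * orbit_norm rho u.
  rewrite -orbit_normZ eqS; apply: le_trans (orbit_norm_sum _ _ _ _) _.
  rewrite rmorph_sum mulr_suml; apply: ler_sum => B _ /=.
  rewrite orbit_normZ ger0_norm ?ler0c ?weight_ge0 //.
  apply: ler_wpM2l; first by rewrite ler0c weight_ge0.
  exact: orbit_norm_avg (subsetT _).
rewrite ler_pM2r ?orbit_norm_gt0 // => le_S.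
have: (S - y)%:C <= S%:C.
  by apply: le_trans le_S; apply: real_ler_norm; rewrite complex_real.
by rewrite lecR lerBlDr lerDl subr_ge0.
Qed.

Hypothesis rho_irr : mx_irreducible rho.

(** Projecting an eigenvector off the vectors fixed by one coordinate subgroup
    gives an eigenvector or 0. If all these projections vanish, the eigenvector is
    fixed by the base group, whose fixed vectors form a submodule because it is
    normal; by irreducibility, the base group then acts trivially. *)
Lemma eigenvalue_ge_degree (x : R) :
    ~ (forall g, rho (Wreath g 1%g) = 1%:M) ->
    eigenvalue (gring_op rho (laplacian G Gamma)) x%:C ->
  exists i, degree i <= x.
Proof.
move=> nontriv /eigenvalueP[v vL nz_v].
have [[i vi] | fixv] := pselect (exists i, v *m J [set i] != v).
  exists i; apply: (@degree_le_eigenvalue i (v - v *m J [set i])).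
  - by rewrite subr_eq0 eq_sym.
  - rewrite mulmxBl -mulmxA [J _ *m _]avg_mx_fix ?subrr // => h Hh.
    exact: avg_mx_repr (subsetT _) Hh.
  by rewrite mulmxBl -mulmxA J1_laplacianC mulmxA vL -scalemxAl scalerBr.
case: nontriv => g.
have sub : base_set G n \subset rstab rho v.
  apply: base_sub => i; apply/subsetP=> w Ww; rewrite !inE /=.
  have /eqP <- : v *m J [set i] == v.
    by apply: contra_notT fixv => vi; exists i.
  by rewrite -mulmxA (avg_mx_repr _ (subsetT _) Ww).
have fix_v : (v <= rfix_mx rho (base_set G n))%MS by rewrite -rfix_mx_rstabC ?subsetT.
have nz_fix : rfix_mx rho (base_set G n) != 0.
  by apply: contraTneq fix_v => ->; rewrite submx0.
have [_ irr] := (mx_irrP rho).1 rho_irr.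
have := irr _ (normal_rfix_mx_module rho (base_normal G n)) nz_fix.
by rewrite -sub1mx => /rfix_mxP fixall; rewrite -[LHS]mul1mx fixall ?inE.
Qed.

End LowerBound.

(** * The upper bound on the regular representation *)

Section HermitianDiagonal.

Local Open Scope sesquilinear_scope.

Variables (C : numClosedFieldType) (n : nat).

(** The diagonal entries of a Hermitian matrix are convex combinations of its
    eigenvalues. *)
Lemma hermitian_eigenvalue_le_diag (A : 'M[C]_n) i : A \is hermsymmx ->
  exists (mu : C) (v : 'rV_n),
    [/\ mu \is Num.real, mu <= A i i, v != 0 & v *m A = mu *: v].
Proof.
move=> hermA; have normA := hermitian_normalmx hermA.
have /orthomx_spectralP defA := normA.
set P := spectralmx A in defA; set D := spectral_diag A in defA.
have uniP : P \is unitarymx by apply: spectral_unitarymx.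
have unitP := unitarymx_unit uniP.
have realD j : D 0 j \is Num.real.
  by have /mxOverP := hermitian_spectral_diag_real hermA; apply.
have sumP : \sum_j `|P j i| ^+ 2 = 1.
  transitivity ((1%:M : 'M[C]_n) i i); last by rewrite mxE eqxx.
  rewrite -(mulVmx unitP) invmx_unitary // mxE; apply: eq_bigr => j _.
  by rewrite !mxE normCK mulrC.
have diagA : A i i = \sum_j D 0 j * `|P j i| ^+ 2.
  rewrite defA invmx_unitary // mxE; apply: eq_bigr => j _.
  rewrite mul_mx_diag !mxE normCK [_ * D 0 j]mulrC -mulrA; congr (_ * _).
  exact: mulrC.
have realA : A i i \is Num.real.
  by rewrite diagA; apply: rpred_sum => j _; rewrite realM ?realX ?normr_real.
have [[j le_j] | gtD] := pselect (exists j, D 0 j <= A i i).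
  exists (D 0 j), (row j P); split=> //.
    apply/eqP=> /(congr1 (mulmx^~ (invmx P))); rewrite rowE mulmxK // mul0mx.
    by move/matrixP/(_ 0 j)/eqP; rewrite !mxE !eqxx oner_eq0.
  rewrite -row_mul defA mulmxA mulKVmx // mul_diag_mx.
  by apply/rowP=> k; rewrite !mxE.
have ltD j : A i i < D 0 j.
  by rewrite real_ltNge //; apply/negP=> le_j; case: gtD; exists j.
have sum0 : \sum_j (D 0 j - A i i) * `|P j i| ^+ 2 = 0.
  under eq_bigr do rewrite mulrBl.
  by rewrite sumrB -mulr_sumr sumP mulr1 -diagA subrr.
have P0 j : P j i = 0.
  have /eqP := sum0; rewrite psumr_eq0 => [/allP/(_ j (mem_index_enum _))|k _].
    by rewrite mulf_eq0 subr_eq0 gt_eqF //= expf_eq0 normr_eq0 => /eqP.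
  by rewrite mulr_ge0 ?exprn_ge0 // subr_ge0 ltW.
move: sumP; rewrite big1 => [/esym/eqP|j _]; first by rewrite oner_eq0.
by rewrite P0 normr0 expr0n.
Qed.

End HermitianDiagonal.

Section RegularEmbedding.

Variables (F : numFieldType) (gT : finGroupType) (G : {group gT}).
Local Notation aG := (regular_repr F G).

Lemma gring_op_sum d (rho : mx_representation F G d) a :
  gring_op rho a = \sum_(k < #|G|) gring_row a 0 k *: rho (enum_val k).
Proof.
rewrite gring_opE /gring_mx /= mulmx_sum_row linear_sum; apply: eq_bigr => k _.
by rewrite linearZ /= rowK mxvecK.
Qed.

Lemma gring_op_hom d1 (r1 : mx_representation F G d1)
    d2 (r2 : mx_representation F G d2) (B : 'M_(d1, d2)) a :
    {in G, forall g, r1 g *m B = B *m r2 g} ->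
  gring_op r1 a *m B = B *m gring_op r2 a.
Proof.
move=> homB; rewrite !gring_op_sum mulmx_suml mulmx_sumr.
apply: eq_bigr => k _.
by rewrite -[LHS]scalemxAl -[RHS]scalemxAr homB ?enum_valP.
Qed.

Lemma mx_rsim_identity d1 (r1 : mx_representation F G d1)
    d2 (r2 : mx_representation F G d2) :
    d1 = d2 -> {in G, forall g, r1 g = 1%:M} -> {in G, forall g, r2 g = 1%:M} ->
  mx_rsim r1 r2.
Proof.
move=> eqd; subst d2 => r1_1 r2_1; exists 1%:M => // [|g Gg].
  by rewrite row_free_unit unitmx1.
by rewrite r1_1 // r2_1.
Qed.

(** The kernel of the average over G: the sum of the nontrivial components of the
    regular representation. *)
Definition avg_ker : 'M[F]_#|G| := kermx (avg_mx aG G).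

Lemma avg_ker_module : mxmodule aG avg_ker.
Proof.
apply: kermx_centg_module; apply/centgmxP=> g Gg.
by rewrite repr_avg_mx ?avg_mx_repr.
Qed.

Definition avg_ker_repr : representation F G :=
  Representation (submod_repr avg_ker_module).

(** The average is the projection onto the fixed vectors, which form a line in the
    regular representation. *)
Lemma regular_split :
  mx_rsim aG (dadd_grepr avg_ker_repr (muln_grepr (triv_grepr F G) 1)).
Proof.
pose T := rfix_mx aG G; have modT : mxmodule aG T := rfix_mx_module aG.
have defT : (avg_mx aG G :=: T)%MS.
  apply/eqmxP/andP; split.
    by apply/rfix_mxP=> g Gg; rewrite avg_mx_repr.
  rewrite -[X in (X <= _)%MS](@avg_mx_fix _ _ _ _ aG G) ?submxMl // => g Gg.
  exact: rfix_mx_id.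
have avgK : avg_mx aG G *m avg_mx aG G = avg_mx aG G.
  by apply: avg_mx_fix => g Gg; rewrite avg_mx_repr.
have sumUT : (avg_ker + T :=: 1%:M)%MS.
  apply/eqmxP; rewrite submx1 /= -[1%:M](subrK (avg_mx aG G)).
  apply: addmx_sub_adds; last by rewrite defT.
  by apply/sub_kermxP; rewrite mulmxBl mul1mx avgK subrr.
have dxUT : mxdirect (avg_ker + T).
  apply/mxdirect_addsP/eqP; rewrite -submx0; apply/rV_subP=> u.
  rewrite sub_capmx => /andP[/sub_kermxP u0 /rfix_mxP uT].
  by rewrite -[u](@avg_mx_fix _ _ _ _ aG G) // u0 sub0mx.
apply: mx_rsim_trans (mx_rsim_sym (rsim_submod1 (mxmodule1 aG) (eqmx_refl _))) _.
apply: (@mx_rsim_dadd _ _ _ _ aG avg_ker T _ avg_ker_repr _ avg_ker_module modT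
  _ sumUT dxUT (mx_rsim_refl _)).
have rankT : \rank T = 1%N.
  have [_ nzT _] := principal_comp_subproof F G.
  apply/eqP; rewrite eqn_leq lt0n mxrank_eq0 nzT andbT.
  by rewrite (rfix_regular F G) rank_leq_row.
rewrite /muln_grepr big_ord_recl big_ord0.
apply: mx_rsim_identity => [|g Gg|g Gg]; first by rewrite rankT.
  rewrite /= /submod_mx (_ : val_submod 1%:M *m _ = val_submod 1%:M) ?val_submodK //.
  have /rfix_mxP fixT : (val_submod (1%:M : 'M_(\rank T)) <= T)%MS.
    by rewrite val_submod1.
  exact: fixT.
by rewrite /= -scalar_mx_block.
Qed.

Lemma avg_ker_no_triv : ~ constituent (triv_grepr F G) avg_ker_repr.
Proof.
case=> U [modU [B eqd freeB homB]].
pose w : 'M_(_, #|G|) := @val_submod _ _ avg_ker _ (val_submod B).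
have fix_w g : g \in G -> w *m aG g = w.
  move=> Gg; rewrite -(val_submodJ avg_ker_module) //.
  rewrite -(val_submodJ modU) //; congr (val_submod (val_submod _)).
  by rewrite -homB // mul1mx.
have /sub_kermxP : (w <= avg_ker)%MS by apply: val_submodP.
rewrite avg_mx_fix // => /eqP; rewrite !val_submod_eq0 => /eqP B0.
by move: freeB; rewrite B0 /row_free mxrank0.
Qed.

(** Matrix coefficients map rho to the regular representation. Taken along a
    coordinate in which v is nonzero, they keep v nonzero; its image is an
    eigenvector annihilated by the average. *)
Lemma avg_ker_eigenvalue d (rho : mx_representation F G d) a (v : 'rV_d) x :
    v != 0 -> v *m avg_mx rho G = 0 -> v *m gring_op rho a = x *: v ->
  eigenvalue (gring_op avg_ker_repr a) x.
Proof.
move=> nz_v v_avg va.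
have [j nz_vj] : exists j, v 0 j != 0.
  apply/existsP; apply: contraR nz_v => /existsPn v0.
  by apply/eqP/rowP=> j; rewrite mxE; apply/eqP/negPn/v0.
(* Row v goes to the function sending g to coordinate j of v rho(g^-1). *)
pose Phi : 'M[F]_(d, #|G|) := \matrix_(i, k) rho (enum_val k)^-1%g i j.
have PhiE u g : g \in G -> (u *m Phi) 0 (gring_index G g) = (u *m rho g^-1%g) 0 j :> F.
  by move=> Gg; rewrite !mxE; apply: eq_bigr => i _; rewrite mxE gring_indexK.
have homPhi : {in G, forall h, rho h *m Phi = Phi *m aG h}.
  move=> h Gh; apply/row_matrixP=> i; rewrite !row_mul.
  apply/rowP=> k; rewrite -[k]gring_valK; have Gk := enum_valP k.
  move: (enum_val k) Gk => g Gg.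
  transitivity (rho (h * g^-1)%g i j).
    by rewrite PhiE // repr_mxM ?groupV // -row_mul [LHS]mxE.
  have Ggh : (g * h^-1)%g \in G by rewrite groupM ?groupV.
  rewrite [RHS]mxE (bigD1 (gring_index G (g * h^-1))) //= big1 => [|l neq_l].
    by rewrite !mxE !gring_indexK // mulgKV !eqxx mulr1 addr0 invMg invgK.
  rewrite !mxE eqxx /=; case: eqP => [eq_l|_]; last by rewrite mulr0.
  case/eqP: neq_l; rewrite -[l]gring_valK; congr (gring_index _ _).
  move/(congr1 enum_val): eq_l; rewrite !gring_indexK ?groupM ?enum_valP //.
  by move=> ->; rewrite mulgK.
pose f := v *m Phi.
have nz_f : f != 0.
  apply: contraNneq nz_vj => /rowP/(_ (gring_index G 1)).
  by rewrite PhiE // invg1 repr_mx1 mulmx1 mxE => ->.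
have f_ker : (f <= avg_ker)%MS.
  apply/sub_kermxP; rewrite /f -mulmxA.
  have <- : avg_mx rho G *m Phi = Phi *m avg_mx aG G.
    rewrite -[LHS]scalemxAl -[RHS]scalemxAr mulmx_suml mulmx_sumr.
    by congr (_ *: _); apply: eq_bigr => g Gg; apply: homPhi.
  by rewrite mulmxA v_avg mul0mx.
apply/eigenvalueP; exists (in_submod avg_ker f); last first.
  by rewrite -val_submod_eq0 in_submodK.
apply: val_submod_inj; rewrite val_submodE -mulmxA.
rewrite (@gring_op_hom _ _ _ aG) => [|g Gg]; last first.
  rewrite -val_submodE -[avg_ker_repr g]mul1mx.
  exact: (val_submodJ avg_ker_module).
rewrite mulmxA -val_submodE [RHS]linearZ /= in_submodK //.
by rewrite /f -mulmxA -(gring_op_hom _ homPhi) mulmxA va scalemxAl.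
Qed.

End RegularEmbedding.

Section NaturalRepresentation.

Variables (F : numFieldType) (G : finGroupType) (n : nat).
Local Notation W := (wreath G n).

Lemma nat_mx_repr : mx_repr [set: W] (fun w => perm_mx (wperm w)^-1%g : 'M[F]_n).
Proof.
split=> [|u v _ _]; first by rewrite wperm1 invg1 perm_mx1.
by rewrite wpermM invMg perm_mxM.
Qed.
Definition nat_repr := MxRepresentation nat_mx_repr.
Local Notation K B := (avg_mx nat_repr (wreath_sub G B)).

Lemma sum_row_perm (s : 'S_n) i : \sum_j (perm_mx s : 'M[F]_n) i j = 1.
Proof.
rewrite (bigD1 (s i)) //= mxE mxE eqxx big1 ?addr0 // => j neq_j.
by rewrite !mxE eq_sym (negPf neq_j).
Qed.

Lemma sum_row_avg B i : \sum_j K B i j = 1.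
Proof.
transitivity (#|wreath_sub G B|%:R^-1 * \sum_(w in wreath_sub G B) (1 : F)).
  under eq_bigr do rewrite mxE summxE.
  rewrite -mulr_sumr exchange_big; congr (_ * _); apply: eq_bigr => w _.
  exact: sum_row_perm.
by rewrite sumr_const mulVf // (card_group_neq0 _ (wreath_sub_group G B)).
Qed.

Lemma avg_nat_out (B : {set 'I_n}) i j : i \in B -> j \notin B -> K B i j = 0.
Proof.
move=> Bi B'j; rewrite mxE summxE big1 ?mulr0 // => w Ww; rewrite !mxE.
case: eqP => // eq_j; case/negP: B'j; rewrite -eq_j.
apply/negPn/negP=> B'wi; have [fix_wi _] := wreath_subP _ _ Ww _ B'wi.
by case/negP: B'wi; rewrite -fix_wi permKV.
Qed.

Lemma avg_nat_fix (B : {set 'I_n}) i : i \notin B -> K B i i = 1.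
Proof.
move=> B'i; rewrite mxE summxE (eq_bigr (fun _ => 1)) => [|w Ww].
  by rewrite sumr_const mulVf // (card_group_neq0 _ (wreath_sub_group G B)).
have [fix_i _] := wreath_subP _ _ Ww _ B'i.
by rewrite !mxE -[in X in X == _]fix_i permK eqxx.
Qed.

(** Averaging over W_B replaces the values on B by their mean: right
    multiplication by a transposition inside B fixes the average. *)
Lemma avg_nat_in (B : {set 'I_n}) i j : i \in B -> j \in B -> K B i j = #|B|%:R^-1.
Proof.
move=> Bi; have const k : k \in B -> K B i k = K B i i.
  move=> Bk; pose t : W := Wreath [ffun=> 1%g] (tperm i k).
  have Wt : t \in wreath_sub_group G B.
    apply/wreath_subP=> l B'l; rewrite ffunE tpermD //.
      by apply: contraNneq B'l => <-.
    by apply: contraNneq B'l => <-.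
  rewrite -[in LHS](avg_mx_repr _ (subsetT _) Wt) /= -col_permE mxE.
  by rewrite /= tpermR.
have := sum_row_avg B i; rewrite (bigID (mem B)) /= [X in _ + X]big1 => [|k]; last first.
  exact: avg_nat_out.
rewrite addr0 (eq_bigr (fun _ => K B i i)) // sumr_const => sumK Bj.
rewrite const //; apply: (mulIf (_ : #|B|%:R != 0)).
  by rewrite pnatr_eq0 -lt0n; apply/card_gt0P; exists i.
rewrite mulr_natr sumK mulVf // pnatr_eq0 -lt0n.
by apply/card_gt0P; exists i.
Qed.

Lemma avg_nat_tr B : (K B)^T = K B.
Proof.
rewrite linearZ linear_sum /=; congr (_ *: _); rewrite [RHS](reindex_inj invg_inj) /=.
apply: eq_big => [w|w _]; first by rewrite (groupV (wreath_sub_group G B)).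
by rewrite tr_perm_mx.
Qed.

Lemma avg_nat_real B : K B \is a mxOver Num.real.
Proof.
apply/mxOverP=> i j; rewrite mxE summxE realM ?realV ?realn //.
by apply: rpred_sum => w _; rewrite !mxE realn.
Qed.

End NaturalRepresentation.

Section UpperBound.

Variables (R : realType) (G : finGroupType) (n : nat) (Gamma : whypergraph R n).
Local Notation C := R[i].
Local Notation M := (gring_op (nat_repr C G n) (laplacian G Gamma)).
Local Notation K B := (avg_mx (nat_repr C G n) (wreath_sub G B)).

Lemma laplacian_nat_tr : M^T = M.
Proof.
rewrite gring_op_laplacian linear_sum; apply: eq_bigr => B _.
by rewrite linearZ linearB /= tr_scalar_mx avg_nat_tr.
Qed.

Lemma laplacian_nat_real : M \is a mxOver Num.real.
Proof.
rewrite gring_op_laplacian; apply/mxOverP=> i j; rewrite summxE.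
apply: rpred_sum => B _; rewrite mxE; apply: realM.
  by apply/complex_realP; exists (Gamma B).
rewrite !mxE realB ?realn //.
by have /mxOverP/(_ i j) := avg_nat_real C G B; rewrite !mxE.
Qed.

Lemma laplacian_nat_const : M *m const_mx 1 = 0 :> 'cV_n.
Proof.
rewrite gring_op_laplacian mulmx_suml big1 // => B _.
rewrite -scalemxAl mulmxBl mul1mx (_ : K B *m _ = const_mx 1) ?subrr ?scaler0 //.
apply/colP=> i; rewrite [LHS]mxE [RHS]mxE -[RHS](sum_row_avg C G B i).
by apply: eq_bigr => j _; rewrite [const_mx _ _ _]mxE mulr1.
Qed.

Lemma laplacian_nat_diag i :
  M i i = \sum_(B : {set 'I_n} | i \in B) (Gamma B)%:C * (1 - #|B|%:R^-1).
Proof.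
have subE (A B : 'M[C]_n) : (A - B) i i = A i i - B i i by rewrite !mxE.
rewrite gring_op_laplacian summxE (bigID (fun B : {set 'I_n} => i \in B)) /=.
rewrite [X in _ + X]big1 ?addr0 => [|B B'i].
  apply: eq_bigr => B Bi; rewrite mxE; congr (_ * _).
  by rewrite subE avg_nat_in // mxE eqxx.
by rewrite mxE subE avg_nat_fix // mxE eqxx subrr mulr0.
Qed.

Lemma not_isolated_weight i : ~ almost_isolated Gamma i ->
  exists B : {set 'I_n}, [/\ i \in B, B \proper [set: 'I_n] & 0 < Gamma B].
Proof.
apply: contra_notP => noB B Bi propB; apply/eqP/negPn/negP=> nz_c.
by apply: noB; exists B; rewrite lt_def nz_c weight_ge0.
Qed.

(** The difference of the two sides is the sum of the c_B (1/|B| - 1/n) over the B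
    containing i; all terms are nonnegative, and that of a proper B of positive
    weight is positive. *)
Lemma laplacian_nat_diag_lt i : ~ almost_isolated Gamma i ->
  M i i + (degree Gamma i)%:C * n%:R^-1 < (degree Gamma i)%:C.
Proof.
move=> /not_isolated_weight[B0 [B0i propB0 c_gt0]].
have n_gt0 : (0 < n)%N by case: (n) i {B0 B0i propB0 c_gt0} => [[]|].
rewrite laplacian_nat_diag /degree rmorph_sum mulr_suml -big_split /=.
have le_card (B : {set 'I_n}) : i \in B -> (0 < #|B| <= n)%N.
  move=> Bi; apply/andP; split; first by apply/card_gt0P; exists i.
  by rewrite -[leqRHS]card_ord max_card.
have termE (B : {set 'I_n}) :
  (Gamma B)%:C * (1 - #|B|%:R^-1) + (Gamma B)%:C * n%:R^-1
    = (Gamma B)%:C - (Gamma B)%:C * (#|B|%:R^-1 - n%:R^-1).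
  by rewrite mulrBr mulr1 mulrBr opprB addrA addrAC.
rewrite (eq_bigr _ (fun B _ => termE B)).
rewrite [ltLHS](bigD1 B0) //= [ltRHS](bigD1 B0) //=.
apply: ltr_leD.
  rewrite gtrDl oppr_lt0 mulr_gt0 ?ltcR // subr_gt0 ltf_pV2 ?posrE ?ltr0n //.
    by rewrite ltr_nat -[ltnRHS]card_ord -cardsT proper_card.
  by case/andP: (le_card _ B0i).
apply: ler_sum => B /andP[Bi _]; have /andP[B_gt0 leBn] := le_card _ Bi.
rewrite gerDl oppr_le0 mulr_ge0 ?ler0c ?weight_ge0 // subr_ge0.
by rewrite lef_pV2 ?posrE ?ltr0n // ler_nat.
Qed.

(** Adding d_i times the projection onto the constants moves the eigenvalue of the
    constants from 0 to d_i. The resulting matrix has a diagonal entry smaller than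
    d_i, hence an eigenvalue smaller than d_i, whose eigenvector must be orthogonal
    to the constants and is therefore an eigenvector of the Laplacian itself. *)
Lemma star_eigenvalue_lt_degree i : ~ almost_isolated Gamma i ->
  exists2 x : R, x < degree Gamma i
    & eigenvalue (gring_op (avg_ker_repr C [set: wreath G n])
        (laplacian G Gamma)) x%:C.
Proof.
move=> not_iso; have n_gt0 : (0 < n)%N by case: (n) i {not_iso} => [[]|].
pose t := (degree Gamma i)%:C; pose A : 'M[C]_n := M + const_mx (t * n%:R^-1).
have t_real : t \is Num.real by apply/complex_realP; exists (degree Gamma i).
have hermA : A \is hermsymmx.
  apply: realsym_hermsym.
    apply/is_hermitianmxP; rewrite expr0 scale1r map_mx_id //.
    by rewrite linearD /= trmx_const laplacian_nat_tr.
  apply: realmxD; first exact: laplacian_nat_real.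
  by apply/mxOverP=> k l; rewrite mxE realM ?realV ?realn.
have [mu [v [mu_real mu_le nz_v vA]]] := hermitian_eigenvalue_le_diag i hermA.
have mu_lt : mu < t.
  by apply: le_lt_trans mu_le _; rewrite mxE [const_mx _ _ _]mxE laplacian_nat_diag_lt.
have A1 : A *m const_mx 1 = t *: const_mx 1 :> 'cV_n.
  rewrite mulmxDl laplacian_nat_const add0r; apply/colP=> k; rewrite !mxE mulr1.
  under eq_bigr do rewrite !mxE mulr1.
  by rewrite sumr_const card_ord -[LHS]mulr_natr divfK // pnatr_eq0 -lt0n.
have sum_v : \sum_j v 0 j = 0.
  have : v *m A *m const_mx 1 = t *: (v *m const_mx 1) :> 'cV_1.
    by rewrite -mulmxA A1 scalemxAr.
  rewrite vA -scalemxAl => /(congr1 (fun B : 'cV_1 => B 0 0)).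
  rewrite !mxE => /eqP; rewrite -subr_eq0 -mulrBl mulf_eq0 subr_eq0 lt_eqF //=.
  by move/eqP; under eq_bigr do rewrite mxE mulr1.
have v_const c : v *m const_mx c = 0 :> 'rV_n.
  apply/rowP=> j; rewrite !mxE; under eq_bigr do rewrite mxE.
  by rewrite -mulr_suml sum_v mul0r.
have [x def_x] := complex_realP _ mu_real.
exists x; first by rewrite -ltcR -def_x.
apply: (@avg_ker_eigenvalue _ _ _ _ (nat_repr C G n) _ v) => //.
  rewrite -(v_const n%:R^-1); congr (v *m _); apply/matrixP=> k l.
  have eqT : wreath_sub G [set: 'I_n] = [set: wreath G n].
    by apply/setP=> w; rewrite [RHS]inE; apply/wreath_subP=> j; rewrite inE.
  have := @avg_nat_in C G n [set: 'I_n] k l (in_setT _) (in_setT _).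
  by rewrite eqT cardsT card_ord => ->; rewrite mxE.
by rewrite -def_x -vA mulmxDr v_const addr0.
Qed.

End UpperBound.

(** * The strict inequality *)

Theorem mainTheorem2 (R : realType) (n : nat) (hn : (2 <= n)%N)
    (G : finGroupType) (Gamma : whypergraph R n)
    (hGamma : ~ exists i : 'I_n, almost_isolated Gamma i)
    (d : nat) (rho : mx_representation R[i] [set: wreath G n]%G d)
    (rho_irr : mx_irreducible rho) (rho_Irr0 : ~ Irr0 rho) :
  (lambda_min_star (laplacian G Gamma) (regular_repr R[i] [set: wreath G n]%G)
     < lambda_min (laplacian G Gamma) rho)%E.
Proof.
have n_gt0 : (0 < n)%N by apply: leq_trans hn.
have not_iso i : ~ almost_isolated Gamma i by move=> iso; apply: hGamma; exists i.
have nontriv : ~ (forall g, rho (Wreath g 1%g) = 1%:M).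
  by move=> base_triv; apply: rho_Irr0; apply: base_triv_Irr0.
case: (Order.TotalTheory.arg_minP (degree Gamma) (isT : xpredT (Ordinal n_gt0))).
move=> i _ min_i.
have [x lt_x eig_x] := star_eigenvalue_lt_degree G (not_iso i).
apply: (@le_lt_trans _ _ x%:E%E).
  apply: ereal_inf_lbound; exists x => //=.
  exists (avg_ker_repr _ _), 1%N.
  by split; [exact: regular_split | exact: avg_ker_no_triv | ].
apply: (@lt_le_trans _ _ (degree Gamma i)%:E%E); first by rewrite lte_fin.
apply/ereal_infP => _ [y eig_y <-].
have [j le_y] := eigenvalue_ge_degree rho_irr nontriv eig_y.
by rewrite lee_fin (le_trans _ le_y) ?min_i.
Qed.
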